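(* Let $A$ be a (commutative) Koszul algebra and let $(\ell_1,\dots,\ell_p)$ be an ideal of $A$ minimally generated by linear forms $\ell_1,\dots,\ell_p$. Let $A\otimes_k B^*_\bullet$ be the complex associated to $(\ell_1,\dots,\ell_p)$ in the context. Then the linear strand of the minimal graded free resolution of the ideal $(\ell_1,\dots,\ell_p)$ is given by the complex $A\otimes_k B^*_\bullet$, that is, it is isomorphic to $$\cdots\to A\otimes_k B^*_d\to A\otimes_k B^*_{d-1}\to\cdots\to A\otimes_k B_2^*\to A\otimes_k B_1^*,$$ with $A\otimes_k B^*_{i+1}$ in homological degree $i$. If $A$ is universally Koszul, then $\cdots\to A\otimes_k B^*_2\to A\otimes_k B^*_1\to A\to0$ is the minimal free resolution of $A/(\ell_1,\dots,\ell_p)$.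
   Context: $k$ is a field; all $k$-algebras are finitely generated and standard graded, and $A=k[x_1,\dots,x_n]/I$ is commutative. $A$ is Koszul if $k$ has a linear graded minimal free resolution over $A$. A Koszul algebra $A$ is universally Koszul if every ideal generated by linear forms has a linear resolution. Linear strand: for a minimal graded $A$-free complex $F_\bullet$ (in nonnegative homological degrees) with $F_0$ of initial degree $d$, the linear strand $F^{\mathrm{lin}}_\bullet$ is the complex obtained by restricting the differentials to the subcomplex generated by the components $(F_i)_{d+i}$. Quadratic dual: write $A=T(V)/Q$ with $V=A_1$, $T(V)$ the tensor algebra and $Q$ an ideal generated by quadrics; $A^!=T(V^* )/Q^\perp$, where $Q^\perp$ is generated by the orthogonal complement of $Q_2$ in $V^*\otimes V^*$ under the pairing $(v_1\otimes v_2)\otimes(u_1\otimes u_2)\mapsto u_1(v_1)u_2(v_2)$. Let $x_1^*,\dots,x_n^*\in A^!_1=V^*$ be the basis dual to the basis $x_1,\dots,x_n$ of $V$. The complex: let $L\subset A^!$ be the left ideal generated by all elements of $V^*=A^!_1$ that vanish on $\ell_1,\dots,\ell_p$ (if $\{\ell_1,\dots,\ell_p\}=\{x_i\mid i\in E\}$, this is $L=\sum_{i\notin E}A^!x_i^*$). Put $B=A^!/L$ and $B_d^*=\operatorname{Hom}_k(B_d,k)$. Then $B^*$ is a right $A^!$-module via $(\phi\cdot a)(b)=\phi(ab)$. The complex $A\otimes_kB^*_\bullet$ is $\cdots\to A\otimes B_d^*\to A\otimes B^*_{d-1}\to\cdots\to A\otimes B_1^*\to A\to0$, with differential right multiplication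 by the trace element $\sum_{i=1}^nx_i\otimes x_i^*$, i.e. $a\otimes\phi\mapsto\sum_i ax_i\otimes\phi x_i^*$; elements of $B_d^*$ have internal degree $d$. *)

(* Defs.v *)
From HB Require Import structures.
From mathcomp Require Import all_boot all_order all_algebra.
From mathcomp.multinomials Require Import mpoly.
From Stdlib Require Import ClassicalEpsilon.

Set Implicit Arguments.
Unset Strict Implicit.
Unset Printing Implicit Defensive.

Import GRing.Theory.
Local Open Scope ring_scope.

(* ------------------------------------------------------------------------ *)
(* Linear algebra: span of an arbitrary set, quotient spaces.               *)

Section Span.
Variables (k : fieldType) (vT : vectType k).

Definition is_span (S : vT -> Prop) (U : {vspace vT}) : Prop :=
  (forall v, S v -> v \in U) /\
  (forall U' : {vspace vT}, (forall v, S v -> v \in U') -> (U <= U')%VS).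

Definition spanP (S : vT -> Prop) : {vspace vT} :=
  epsilon (inhabits 0%VS) (is_span S).

Lemma spanPP (S : vT -> Prop) : is_span S (spanP S).
Proof.
apply: epsilon_spec; pose up (U : {vspace vT}) := forall v, S v -> v \in U.
suff [U SU minU] : exists2 U, up U & forall U', up U' -> (\dim U <= \dim U')%N.
  exists U; split=> // U' SU'.
  have SI : up (U :&: U')%VS by move=> v Sv; rewrite memv_cap SU ?SU'.
  have /eqP <- : (U :&: U')%VS == U by rewrite eqEdim capvSl minU.
  exact: capvSr.
suff H m U : up U -> (\dim U <= m)%N ->
    exists2 U, up U & forall U', up U' -> (\dim U <= \dim U')%N.
  by apply: (H _ fullv _ (leqnn _)) => v _; rewrite memvf.
elim: m U => [|m IHm] U SU leUm.
  by exists U => // U' _; apply: leq_trans leUm _.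
case: (classic (exists2 U', up U' & (\dim U' < \dim U)%N)) => [[U' SU' lt]|nex].
  by apply: (IHm U') => //; rewrite -ltnS (leq_trans lt).
exists U => // U' SU'; rewrite leqNgt; apply/negP => lt.
by apply: nex; exists U'.
Qed.

Lemma spanP_linear (P : vT -> Prop) :
    P 0 -> (forall a u v, P u -> P v -> P (a *: u + v)) ->
  forall v, (v \in spanP P) <-> P v.
Proof.
move=> P0 Plin v; have [Pin minP] := spanPP P; split; last exact: Pin.
suff [U PU maxU] : exists2 U : {vspace vT}, (forall u, u \in U -> P u)
      & forall u, P u -> u \in U.
  by move=> /(subvP (minP U maxU)) /PU.
pose ok (U : {vspace vT}) := forall u, u \in U -> P u.
suff H m U : ok U -> (\dim {:vT} - \dim U <= m)%N ->
    exists2 U : {vspace vT}, ok U & forall u, P u -> u \in U.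
  by apply: (H _ 0%VS _ (leqnn _)) => u; rewrite memv0 => /eqP->.
elim: m U => [|m IHm] U PU.
  rewrite leqn0 subn_eq0 => le; exists U => // u _.
  suff /eqP -> : U == fullv by rewrite memvf.
  by rewrite eqEdim subvf.
move=> leUm; case: (classic (forall u, P u -> u \in U)) => [|nall].
  by exists U.
have [u nu] : exists u, ~ (P u -> u \in U) by apply: not_all_ex_not.
have [Pu uNU] : P u /\ u \notin U.
  split; first by case: (classic (P u)) => // nPu; case: nu.
  by apply/negP => uU; apply: nu.
apply: (IHm (<[u]> + U)%VS).
  by move=> w /memv_addP[_ /vlineP[a ->] [w' /PU Pw' ->]]; apply: Plin.
have lt : (\dim U < \dim (<[u]> + U))%N.
  rewrite ltn_neqAle dimvS ?addvSr // andbT; apply/negP => /eqP e.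
  have /eqP eqU : U == (<[u]> + U)%VS by rewrite eqEdim addvSr e /=.
  by case/negP: uNU; rewrite eqU memvE addvSl.
have := dimvS (subvf (<[u]> + U)%VS).
rewrite leq_subLR in leUm *; rewrite leq_subLR => _.
by apply: leq_trans leUm _; rewrite addnS -addSn leq_add2r.
Qed.

End Span.

(* vT / W, realised on the complement of W chosen by the library. *)
Section Quotient.
Variables (k : fieldType) (vT : vectType k) (W : {vspace vT}).

Definition quotv : vectType k := subvs_of (W^C)%VS.

Definition qproj (v : vT) : quotv := vsproj (W^C)%VS (daddv_pi (W^C)%VS W v).

Definition qrepr (b : quotv) : vT := vsval b.

Lemma qproj_is_linear : linear qproj.
Proof. by move=> a u v; rewrite /qproj !linearP. Qed.

HB.instance Definition _ :=
  GRing.isLinear.Build k vT quotv *:%R qproj qproj_is_linear.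

Lemma qrepr_is_linear : linear qrepr.
Proof. by move=> a u v; rewrite /qrepr linearP. Qed.

HB.instance Definition _ :=
  GRing.isLinear.Build k quotv vT *:%R qrepr qrepr_is_linear.

Lemma capCv : (W^C :&: W)%VS = 0%VS.
Proof. by rewrite capvC capv_compl. Qed.

Lemma qreprK : cancel qrepr qproj.
Proof.
move=> b; rewrite /qproj /qrepr daddv_pi_id ?vsvalK ?capCv //; exact: subvsP.
Qed.

Lemma qproj_eq0 v : (qproj v == 0) = (v \in W).
Proof.
have dec := daddv_pi_add capCv (_ : v \in (W^C + W)%VS).
have /dec {dec} dec : v \in (W^C + W)%VS by rewrite addvC addv_complf memvf.
have piP : daddv_pi (W^C)%VS W v \in (W^C)%VS := memv_pi _ _ v.
apply/eqP/idP => [/(congr1 vsval) | vW].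
  rewrite /qproj vsprojK ?piP // linear0 => e.
  by rewrite -dec e add0r memv_pi.
have e : daddv_pi W (W^C)%VS v = v by rewrite daddv_pi_id ?capv_compl.
have /eqP : daddv_pi (W^C)%VS W v = 0.
  by apply: (addIr v); rewrite -{2}e dec add0r.
by rewrite /qproj => /eqP->; rewrite linear0.
Qed.

End Quotient.

(* ------------------------------------------------------------------------ *)
(* Graded pieces of a tensor algebra on n letters.                          *)

Section Tensor.
Variables (k : fieldType) (n : nat).

(* The d-th tensor power of an n-dimensional space with a fixed basis: f
   stands for the combination of the words w in the basis with coefficients
   f w.  It serves both for V (basis x_i) and for V^* (dual basis x_i^* ). *)
Definition tens (d : nat) : vectType k := {ffun d.-tuple 'I_n -> k^o}.

Definition tword (d : nat) (w : d.-tuple 'I_n) : tens d :=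
  [ffun u => (u == w)%:R].

(* Product of T_i and T_j, landing in T_d: meaningful when d = i + j, and 0
   otherwise.  Leaving d free avoids transports along equalities of degrees. *)
Definition tmul (i j d : nat) (f : tens i) (g : tens j) : tens d :=
  [ffun w : d.-tuple 'I_n =>
     \sum_(u : i.-tuple 'I_n) \sum_(v : j.-tuple 'I_n | val w == val u ++ val v)
        f u * g v].

(* Evaluation of tensors in V^* on tensors in V; on decomposable tensors this
   is the product of the evaluations of the factors. *)
Definition tpair (d : nat) (f g : tens d) : k := \sum_w f w * g w.

End Tensor.

(* ------------------------------------------------------------------------ *)
(* Standard graded algebras A = k[x_1..x_n]/I.                              *)

Section GradedAlgebra.
Variables (k : fieldType) (n : nat) (A : comAlgType k).
Variable pi : {lrmorphism {mpoly k[n]} -> A}.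

(* I is the kernel of pi; since it contains no nonzero linear form, the images
   of the variables are a basis of A_1. *)
Record standard_graded : Prop := StandardGraded {
  sg_surj : forall a, exists q, a = pi q;
  sg_homog : forall q d, pi q = 0 -> pi (pihomog mdeg d q) = 0;
  sg_linear : forall q, q \is 1.-homog -> pi q = 0 -> q = 0 }.

Definition gen (i : 'I_n) : A := pi 'X_i.

Definition graded_piece (d : nat) (a : A) : Prop := exists2 q, q \is d.-homog & a = pi q.

(* a is homogeneous of degree j in A(-i) *)
Definition shifted_piece (i j : nat) (a : A) : Prop :=
  if (i <= j)%N then graded_piece (j - i) a else a = 0.

(* The map from the tensor algebra of V = A_1 to A, in degree d. *)
Definition tev (d : nat) (f : tens k n d) : A := \sum_w f w *: \prod_(i <- w) gen i.

Definition ideal_gen (p : nat) (s : 'I_p -> A) (a : A) : Prop :=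
  exists c : 'I_p -> A, a = \sum_i c i * s i.

Definition zero_ideal (a : A) : Prop := a = 0.
Definition unit_ideal (a : A) : Prop := True.
Definition irrelevant : A -> Prop := ideal_gen gen.

Definition minimally_generates (p : nat) (s : 'I_p -> A) : Prop :=
  forall j, ~ exists c : 'I_p -> A, s j = \sum_(i | i != j) c i * s i.

(* Linear forms are given as elements of V, i.e. by their coordinates. *)
Definition linform (p : nat) (l : 'I_p -> tens k n 1) (j : 'I_p) : A := tev (l j).

(* ------------------------------------------------------------------------ *)
(* Graded free complexes and resolutions.                                   *)

(* F_i = \bigoplus_b A(- dg i b), as row vectors; the differential
   F_(i+1) -> F_i is v |-> v *m df i. *)
Record gfcomplex := GFComplex {
  rk : nat -> nat;
  dg : forall i, 'I_(rk i) -> nat;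
  df : forall i, 'M[A]_(rk i.+1, rk i) }.

(* The graded component (F_i)_j. *)
Definition component (F : gfcomplex) (i j : nat) (v : 'rV[A]_(rk F i)) : Prop :=
  forall b, shifted_piece (dg b) j (v 0 b).

Definition augment (F : gfcomplex) (e : 'I_(rk F 0) -> A) (v : 'rV[A]_(rk F 0)) : A :=
  \sum_b v 0 b * e b.

(* F, with augmentation sending the b-th basis vector of F_0 to the class of
   e b, is a graded free resolution of the subquotient N / M of A, where
   M <= N are homogeneous ideals. *)
Record resolution (F : gfcomplex) (e : 'I_(rk F 0) -> A) (N M : A -> Prop) : Prop :=
  Resolution {
  res_graded : forall i (a : 'I_(rk F i.+1)), component (dg a) (row a (df F i));
  res_exact : forall i (v : 'rV[A]_(rk F i.+1)),
    v *m df F i = 0 <-> exists w, v = w *m df F i.+1;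
  aug_graded : forall b : 'I_(rk F 0), graded_piece (dg b) (e b);
  aug_in : forall b, N (e b);
  aug_surj : forall y, N y -> exists v, M (y - augment e v);
  aug_exact : forall v, M (augment e v) <-> exists w, v = w *m df F 0 }.

Definition minimal (F : gfcomplex) : Prop :=
  forall i a b, irrelevant (df F i a b).

Definition minimal_resolution (F : gfcomplex) (e : 'I_(rk F 0) -> A)
    (N M : A -> Prop) : Prop :=
  resolution e N M /\ minimal F.

(* N / M has a minimal free resolution with F_i generated in degree d + i. *)
Definition has_linear_resolution (d : nat) (N M : A -> Prop) : Prop :=
  exists (F : gfcomplex) (e : 'I_(rk F 0) -> A),
    minimal_resolution e N M /\ forall i (b : 'I_(rk F i)), dg b = (d + i)%N.

Definition Koszul : Prop := has_linear_resolution 0 unit_ideal irrelevant.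

Definition universally_Koszul : Prop :=
  Koszul /\ forall (p : nat) (l : 'I_p -> tens k n 1),
    has_linear_resolution 1 (ideal_gen (linform l)) zero_ideal.

Definition submod_gen (m : nat) (S : 'rV[A]_m -> Prop) (v : 'rV[A]_m) : Prop :=
  exists (r : nat) (a : 'I_r -> A) (s : 'I_r -> 'rV[A]_m),
    (forall t, S (s t)) /\ v = \sum_t a t *: s t.

Definition initial_degree (F : gfcomplex) (d : nat) : Prop :=
  (exists2 v : 'rV[A]_(rk F 0), component d v & v != 0) /\
  (forall j (v : 'rV[A]_(rk F 0)), (j < d)%N -> component j v -> v = 0).

(* When F_0 = 0 there is no initial degree and the strand is zero. *)
Definition linear_strand (F : gfcomplex) (i : nat) : 'rV[A]_(rk F i) -> Prop :=
  submod_gen (fun v => exists2 d, initial_degree F d & component (d + i) v).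

(* Isomorphism of graded complexes from K onto the linear strand of F. *)
Definition iso_linear_strand (K F : gfcomplex) : Prop :=
  exists Phi : forall i, 'M[A]_(rk K i, rk F i),
  [/\ forall i (a : 'I_(rk K i)), component (dg a) (row a (Phi i)),
      forall i (v : 'rV[A]_(rk K i)), v *m Phi i = 0 -> v = 0,
      forall i (w : 'rV[A]_(rk F i)),
        linear_strand w <-> exists v, w = v *m Phi i
    & forall i, df K i *m Phi i = Phi i.+1 *m df F i].

(* Drops homological degree 0 and shifts the rest down by one. *)
Definition tail_complex (K : gfcomplex) : gfcomplex :=
  {| rk i := rk K i.+1; dg i := @dg K i.+1; df i := df K i.+1 |}.

(* ------------------------------------------------------------------------ *)
(* The quadratic dual, and the complex attached to linear forms.            *)

(* Q_2, in V (x) V. *)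
Definition quadrics : {vspace tens k n 2} := spanP (fun f => tev f = 0).

Definition quadrics_orth : {vspace tens k n 2} :=
  spanP (fun f => forall g, g \in quadrics -> tpair f g = 0).

(* Degree d component of the two-sided ideal of T(V^* ) generated by
   quadrics_orth. *)
Definition orth_ideal (d : nat) : {vspace tens k n d} :=
  spanP (fun f => exists i j (a : tens k n i) q (b : tens k n j),
    [/\ (i + 2 + j)%N = d, q \in quadrics_orth
      & f = tmul d (tmul (i + 2) a q) b]).

(* The component of degree d of the quadratic dual of A. *)
Definition qdual (d : nat) : vectType k := quotv (orth_ideal d).

(* As for tmul, the degree d of the product is to be i + j. *)
Definition qdmul (i j d : nat) (a : qdual i) (b : qdual j) : qdual d :=
  qproj (orth_ideal d) (tmul d (qrepr a) (qrepr b)).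

Definition xstar (i : 'I_n) : qdual 1 := qproj (orth_ideal 1) (tword k [tuple i]).

Section Forms.
Variables (p : nat) (l : 'I_p -> tens k n 1).

(* Degree d component of the left ideal L of the quadratic dual. *)
Definition vanishing_left_ideal (d : nat) : {vspace qdual d} :=
  spanP (fun f => exists i (a : qdual i) (u : tens k n 1),
    [/\ (i + 1)%N = d, forall j, tpair u (l j) = 0
      & f = qdmul d a (qproj (orth_ideal 1) u)]).

Definition Bmod (d : nat) : vectType k := quotv (vanishing_left_ideal d).

Definition Bone : Bmod 0 :=
  qproj (vanishing_left_ideal 0) (qproj (orth_ideal 0) (tword k [tuple])).

Definition Bact (i j d : nat) (a : qdual i) (b : Bmod j) : Bmod d :=
  qproj (vanishing_left_ideal d) (qdmul d a (qrepr b)).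

Definition Bdual (d : nat) : vectType k := 'Hom(Bmod d, k^o).

Definition Bdual_act (i j d : nat) (phi : Bdual d) (a : qdual i) : Bdual j :=
  linfun (fun b : Bmod j => phi (Bact d a b)).

Lemma Bdual_actE (i j d : nat) (phi : Bdual d) (a : qdual i) (b : Bmod j) :
  Bdual_act j phi a b = phi (Bact d a b).
Proof.
have lin : linear (fun b : Bmod j => phi (Bact d a b) : k^o).
  move=> c u v; rewrite /Bact /qdmul -linearP; congr (phi _).
  rewrite -linearP; congr (qproj _ _); rewrite -linearP; congr (qproj _ _).
  apply/ffunP => w; rewrite !ffunE !linearP /=.
  rewrite scaler_sumr -big_split; apply: eq_bigr => s _.
  rewrite scaler_sumr -big_split; apply: eq_bigr => t _.
  by rewrite !ffunE /= mulrDr mulrCA.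
pose h := GRing.isLinear.Build k (Bmod j) k^o *:%R _ lin.
pose g : {linear Bmod j -> k^o} := HB.pack (fun b : Bmod j => phi (Bact d a b) : k^o) h.
exact: (lfunE g b).
Qed.

(* A (x)_k B^*_d is free over A on the k-basis of B^*_d provided by the
   library; row s of the differential expands
   \sum_i x_i (x) (phi_s x_i^* ) on the basis of B^*_(d-1). *)
Definition dual_complex : gfcomplex :=
  {| rk d := \dim {: Bdual d};
     dg d _ := d;
     df d := \matrix_(s < \dim {: Bdual d.+1}, t < \dim {: Bdual d})
       \sum_i coord (vbasis {: Bdual d}) t
                (Bdual_act d (vbasis {: Bdual d.+1})`_s (xstar i)) *: gen i |}.

(* The identification of A (x)_k B^*_0 with A: a (x) phi |-> phi(1) a. *)
Definition dual_augmentation (s : 'I_(rk dual_complex 0)) : A :=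
  ((vbasis {: Bdual 0})`_s Bone)%:A.

End Forms.
End GradedAlgebra.

(* Main.v *)
Require Import Defs.
From HB Require Import structures.
From mathcomp Require Import all_boot all_order all_algebra.
From mathcomp.multinomials Require Import mpoly.
From Stdlib Require Import ClassicalEpsilon.

Set Implicit Arguments.
Unset Strict Implicit.
Unset Printing Implicit Defensive.

Import GRing.Theory.
Local Open Scope ring_scope.

(** Let G be a minimal graded free resolution of A/(l_1, ..., l_p): a minimal
    resolution F of the ideal, moved up by one homological degree, with A put
    in front.  Let W_i be the k-span of the basis elements of degree i of G_i.
    Minimality leaves no generator of G_i in degree below i, so the linear
    strand of F is formed by the A (x) W_i with i > 0.  Exactness of G in
    internal degree i + 2, where minimality again removes G_(i+3) and keeps the
    images of the generators inside the maximal ideal, reads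
      W_(i+2) = ker (A_1 (x) W_(i+1) -> A_2 (x) W_i),
    while W_0 = k and W_1 is the span U of the l_j in V = A_1.  The strand is
    therefore determined by a recursion of linear algebra, and the proof shows
    that the spaces D_d dual to B_d obey the same recursion.

    A functional on B_d is a functional on the d-th tensor power of the dual of
    V, hence a tensor in V^(x)d (theta).  Vanishing on the two-sided ideal of
    Q^perp says that any two adjacent letters contract to 0 with Q^perp
    (quad_killed), and vanishing on the left ideal L says that the last letter
    contracts to 0 with the forms orthogonal to U (form_killed); these are the
    only conditions (theta_onto).  The differential of A (x) D reads off the
    first letter (theta_act, tensor_df).  So an element of V (x) D_(d+1) lies in
    D_(d+2) as soon as its first two letters contract to 0 with Q^perp, that is,
    lie in Q_2 by double orthogonality, that is, have product 0 in A_2.  This is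
    df_linear_exact; df0_linear_exact is the start D_1 = U, and df_scalar_inj
    says that D_(d+1) embeds in V (x) D_d.

    Comparing the recursions, strand_step extends an isomorphism of D_i with
    W_i by one step, compatibly with the differentials, and extending scalars
    to A gives the isomorphism of A (x) D with the linear strand
    (linear_strand_dual).  If the ideal has a linear resolution, G is its own
    linear strand together with A, so A (x) D is isomorphic to G and inherits
    its exactness (linear_resolution_dual). *)

(** * Homogeneous components of elements of A *)

Lemma pihomogM_homog (k : fieldType) (n d e : nat) (P Q : {mpoly k[n]}) :
    Q \is e.-homog ->
  pihomog mdeg d (P * Q) =
    if (e <= d)%N then pihomog mdeg (d - e) P * Q else 0.
Proof.
move=> hQ; rewrite {1}(pihomog_partitionE (leq_maxl (mmeasure mdeg P) d.+1)).
rewrite mulr_suml linear_sum /=.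
have hM i : pihomog mdeg i P * Q \is (i + e).-homog.
  by rewrite dhomogM ?pihomogP.
case: leqP => led.
  have ltd : (d - e < maxn (mmeasure mdeg P) d.+1)%N.
    by rewrite leq_max ltnS leq_subr orbT.
  rewrite (bigD1 (Ordinal ltd)) //= big1 ?addr0 => [|i].
    by rewrite pihomog_dE //; have := hM (d - e)%N; rewrite subnK.
  rewrite -val_eqE /= => ne; apply: pihomog_ne0 (hM i).
  by apply: contra ne; move: (nat_of_ord i) => j /eqP <-; rewrite addnK.
apply: big1 => i _; apply: pihomog_ne0 (hM i).
by move: (nat_of_ord i) => j; apply: contraTneq led => <-; rewrite -leqNgt
  leq_addl.
Qed.

Section Graded.
Variables (k : fieldType) (n : nat) (A : comAlgType k).
Variable pi : {lrmorphism {mpoly k[n]} -> A}.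
Hypothesis hA : standard_graded pi.

Local Notation gen := (gen pi).
Local Notation piece := (graded_piece pi).
Local Notation spiece := (shifted_piece pi).

(** pi as a plain function on polynomials, so that rewriting does not
    depend on the structure under which its domain is seen. *)
Definition toA (q : {mpoly k[n]}) : A := pi q.

Lemma toAD : {morph toA : q q' / q + q'}. Proof. exact: rmorphD. Qed.
Lemma toAB : {morph toA : q q' / q - q'}. Proof. exact: rmorphB. Qed.
Lemma toAM : {morph toA : q q' / q * q'}. Proof. exact: rmorphM. Qed.
Lemma toA0 : toA 0 = 0. Proof. exact: rmorph0. Qed.
Lemma toA1 : toA 1 = 1. Proof. exact: rmorph1. Qed.
Lemma toAZ c q : toA (c *: q) = c *: toA q. Proof. exact: linearZ. Qed.

Lemma toA_sum (I : Type) (r : seq I) (P : pred I) (F : I -> {mpoly k[n]}) :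
  toA (\sum_(i <- r | P i) F i) = \sum_(i <- r | P i) toA (F i).
Proof. exact: (big_morph toA toAD toA0). Qed.

Definition lift (a : A) : {mpoly k[n]} :=
  epsilon (inhabits 0) (fun q => a = toA q).

Lemma liftK a : toA (lift a) = a.
Proof.
exact/esym/(epsilon_spec (inhabits 0) (fun q => a = toA q) (sg_surj hA a)).
Qed.

Definition hcomp (d : nat) (a : A) : A := toA (pihomog mdeg d (lift a)).

(** Homogeneity of the kernel of pi makes the component independent of the
    chosen lift. *)
Lemma hcompE d q : hcomp d (toA q) = toA (pihomog mdeg d q).
Proof.
apply/eqP; rewrite -subr_eq0 /hcomp -toAB -linearB /=; apply/eqP.
by apply: (sg_homog hA); apply: etrans (toAB _ _) _; rewrite liftK subrr.
Qed.

Lemma hcomp_sum d (I : Type) (r : seq I) (P : pred I) (F : I -> A) :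
  hcomp d (\sum_(i <- r | P i) F i) = \sum_(i <- r | P i) hcomp d (F i).
Proof.
have -> : \sum_(i <- r | P i) F i = toA (\sum_(i <- r | P i) lift (F i)).
  by rewrite toA_sum; apply: eq_bigr => i _; rewrite liftK.
by rewrite hcompE linear_sum toA_sum.
Qed.

Lemma hcomp_piece d a : piece d (hcomp d a).
Proof. by exists (pihomog mdeg d (lift a)); rewrite ?pihomogP. Qed.

Lemma hcomp_id d a : piece d a -> hcomp d a = a.
Proof. by case=> q hq ->; rewrite hcompE pihomog_dE. Qed.

Lemma hcompM d e a y : piece e y ->
  hcomp d (a * y) = if (e <= d)%N then hcomp (d - e) a * y else 0.
Proof.
case=> q hq ->; rewrite -/(toA q) -{1}(liftK a) -toAM hcompE.
rewrite (pihomogM_homog _ _ hq).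
by case: ifP => _; rewrite ?toA0 // toAM.
Qed.

Lemma piece_gen i : piece 1 (gen i).
Proof. by exists 'X_i; rewrite // dhomogX; apply/eqP/mdeg1. Qed.

Lemma piece_sum d (I : Type) (r : seq I) (P : pred I) (F : I -> A) :
  (forall i, P i -> piece d (F i)) -> piece d (\sum_(i <- r | P i) F i).
Proof.
move=> hF; apply: (big_ind (piece d)) => //.
  by exists 0; rewrite ?dhomog0 // -/(toA 0) toA0.
move=> _ _ [q hq ->] [q' hq' ->]; exists (q + q'); last exact/esym/toAD.
by rewrite rpredD.
Qed.

Lemma pieceZ d c a : piece d a -> piece d (c *: a).
Proof.
by case=> q hq ->; exists (c *: q); rewrite ?rpredZ //; apply/esym/toAZ.
Qed.

Lemma piece0 d : piece d 0.
Proof. by exists 0; rewrite ?dhomog0 // -/(toA 0) toA0. Qed.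

Lemma piece_scalar c : piece 0 c%:A.
Proof. by apply: pieceZ; exists 1; rewrite ?dhomog1 // -/(toA 1) toA1. Qed.

Lemma piece0P a : piece 0 a -> exists c, a = c%:A.
Proof.
case=> q /dhomogP hq ->; exists q@_0%MM.
rewrite -/(toA q) {1}(mpolyE q) toA_sum.
under eq_bigr do rewrite toAZ.
have h0 m : m \in msupp q -> m = 0%MM.
  by move=> /hq /eqP; rewrite mdeg_eq0 => /eqP.
have [q0|q0] := boolP (0%MM \in msupp q).
  rewrite (bigD1_seq 0%MM) ?msupp_uniq //= big_seq_cond big1 ?addr0.
    by rewrite mpolyX0 toA1.
  by move=> m /andP[/h0 ->]; rewrite eqxx.
rewrite big_seq big1 => [|m mq]; last first.
  by case/negP: q0; rewrite -(h0 _ mq).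
by rewrite memN_msupp_eq0 // scale0r.
Qed.

Lemma mcoeff_linear (c : 'I_n -> k) i :
  (\sum_j c j *: 'X_j : {mpoly k[n]})@_U_(i) = c i.
Proof.
rewrite linear_sum /= (bigD1 i) //= big1 ?addr0 => [|j ji].
  by rewrite linearZ /= mcoeffX eqxx mulr1.
rewrite linearZ /= mcoeffX; case: eqP => [/mnmP/(_ i)|_]; last by rewrite mulr0.
by rewrite !mnmE eqxx (negbTE ji).
Qed.

Lemma dhomog_linear (c : 'I_n -> k) :
  (\sum_j c j *: 'X_j : {mpoly k[n]}) \is 1.-homog.
Proof.
by apply: rpred_sum => j _; rewrite rpredZ // dhomogX; apply/eqP/mdeg1.
Qed.

Lemma toA_linear (c : 'I_n -> k) :
  toA (\sum_j c j *: 'X_j) = \sum_j c j *: gen j.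
Proof. by rewrite toA_sum; apply: eq_bigr => i _; rewrite toAZ. Qed.

Lemma piece1P a : piece 1 a -> exists c : 'I_n -> k, a = \sum_i c i *: gen i.
Proof.
case=> q hq ->; exists (fun i => q@_U_(i)); rewrite -toA_linear.
congr toA; apply/mpolyP => m.
have [/mdeg1P[i /eqP ->]|m1] := boolP (mdeg m == 1%N).
  by rewrite mcoeff_linear.
by rewrite !(@dhomog_nemf_coeff _ _ mdeg 1) ?dhomog_linear.
Qed.

Lemma piece1_linear (c : 'I_n -> k) : piece 1 (\sum_i c i *: gen i).
Proof. by apply: piece_sum => i _; apply/pieceZ/piece_gen. Qed.

Lemma gen_free (c : 'I_n -> k) : \sum_i c i *: gen i = 0 -> forall i, c i = 0.
Proof.
rewrite -toA_linear => /(sg_linear hA (dhomog_linear c)) q0 i.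
by rewrite -(mcoeff_linear c) q0 mcoeff0.
Qed.

Lemma irrelevant_hcomp0 a : irrelevant pi a -> hcomp 0 a = 0.
Proof.
case=> c ->; rewrite hcomp_sum big1 // => i _.
by rewrite (hcompM _ _ (piece_gen i)).
Qed.

(** Nakayama for graded modules comes down to this: the maximal ideal has
    no component in degree 0. *)
Lemma irrelevant_scalar c : irrelevant pi c%:A -> c = 0.
Proof.
move=> /irrelevant_hcomp0; rewrite (hcomp_id (piece_scalar c)) => /eqP.
by rewrite scaler_eq0 oner_eq0 orbF => /eqP.
Qed.

Lemma irrelevant_piece0 a : irrelevant pi a -> piece 0 a -> a = 0.
Proof. by move=> /irrelevant_hcomp0 h /hcomp_id <-. Qed.

Lemma irrelevant_sum (I : Type) (r : seq I) (P : pred I) (F : I -> A) :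
    (forall i, P i -> irrelevant pi (F i)) ->
  irrelevant pi (\sum_(i <- r | P i) F i).
Proof.
move=> hF; apply: (big_ind (irrelevant pi)) => //.
  by exists (fun=> 0); rewrite big1 // => i _; rewrite mul0r.
move=> _ _ [c ->] [c' ->]; exists (fun i => c i + c' i).
by rewrite -big_split; apply: eq_bigr => i _; rewrite mulrDl.
Qed.

Lemma irrelevantM a b : irrelevant pi b -> irrelevant pi (a * b).
Proof.
case=> c ->; exists (fun i => a * c i).
by rewrite mulr_sumr; apply: eq_bigr => i _; rewrite mulrA.
Qed.

(** The projection of A(-i) onto its component of degree j. *)
Definition shcomp (i j : nat) (a : A) : A :=
  if (i <= j)%N then hcomp (j - i) a else 0.

Lemma shcomp_piece i j a : spiece i j (shcomp i j a).
Proof.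
by rewrite /shifted_piece /shcomp; case: leqP => // _; apply: hcomp_piece.
Qed.

Lemma shcomp_id i j a : spiece i j a -> shcomp i j a = a.
Proof.
by rewrite /shifted_piece /shcomp; case: leqP => // _; apply: hcomp_id.
Qed.

Lemma shcomp_sum i j (I : Type) (r : seq I) (P : pred I) (F : I -> A) :
  shcomp i j (\sum_(s <- r | P s) F s) = \sum_(s <- r | P s) shcomp i j (F s).
Proof. by rewrite /shcomp; case: ifP => _; rewrite ?hcomp_sum // big1. Qed.

(** A matrix entry y between generators of degrees b and c is homogeneous
    of degree b - c, so multiplying by it commutes with the projections onto the
    part of degree j of A(-b) and A(-c), including where one of these is 0. *)
Lemma shcompM c b j w y : spiece c b y -> shcomp c j (w * y) = shcomp b j w * y.
Proof.
rewrite /shifted_piece /shcomp; case: (leqP c b) => [lecb|ltbc] hy; last first.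
  by rewrite hy !mulr0; case: ifP => // _; rewrite (hcomp_id (piece0 _)).
case: (leqP c j) => [lecj|ltjc].
  rewrite (hcompM _ _ hy) leq_sub2rE // -subnDA subnKC //.
  by case: ifP => // _; rewrite mul0r.
by rewrite leqNgt (leq_trans ltjc lecb) mul0r.
Qed.

End Graded.

(** * Tensors as functions on words *)

Section Words.
Variables (k : fieldType) (n : nat).
Local Notation tens := (tens k n).

(** The kernel of h is one of the subspaces that contain S. *)
Lemma spanP_ker (vT : vectType k) (h : {linear vT -> k^o}) (S : vT -> Prop) :
  (forall v, S v -> h v = 0) -> forall v, v \in spanP S -> h v = 0.
Proof.
move=> hS v; have [_ minS] := spanPP S.
have /minS/subvP/[apply] : forall v, S v -> v \in lker (linfun h).
  by move=> u /hS h0; rewrite memv_ker lfunE /= h0.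
by rewrite memv_ker lfunE /= => /eqP.
Qed.

Lemma qrepr_qproj (vT : vectType k) (W : {vspace vT}) (v : vT) :
  v - qrepr (qproj W v) \in W.
Proof. by rewrite -qproj_eq0 linearB /= qreprK subrr. Qed.

(** Extending a tensor by 0 to words of any length lets it be evaluated on
    concatenations without transport along equalities of lengths. *)
Definition evw (d : nat) (g : tens d) (s : seq 'I_n) : k :=
  if insub s is Some t then g t else 0.

Lemma evwE d (g : tens d) (t : d.-tuple 'I_n) : evw g t = g t.
Proof. by rewrite /evw valK. Qed.

Lemma evw_size d (g : tens d) s : size s != d -> evw g s = 0.
Proof. by move=> hs; rewrite /evw insubF //; apply/negbTE. Qed.

Lemma evw_ffun d (F : seq 'I_n -> k) s : size s = d ->
  evw ([ffun t : d.-tuple 'I_n => F t] : tens d) s = F s.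
Proof. by move=> /eqP hs; rewrite (evwE _ (Tuple hs)) ffunE. Qed.

Lemma evw_sum d (g : tens d) (s : seq 'I_n) :
  \sum_(w : d.-tuple 'I_n | val w == s) g w = evw g s.
Proof.
have [hs|hs] := boolP (size s == d); last first.
  rewrite evw_size // big1 // => w /eqP e; case/negP: hs.
  by rewrite -e size_tuple.
by rewrite (big_pred1 (Tuple hs)) ?(evwE _ (Tuple hs)).
Qed.

Definition pairing d (g : tens d) (f : tens d) : k^o := tpair f g.

Lemma pairing_is_linear d (g : tens d) : linear (pairing g).
Proof.
move=> c f f'; rewrite /pairing /tpair scaler_sumr -big_split.
by apply: eq_bigr => w _; rewrite !ffunE mulrDl -scalerAl.
Qed.
HB.instance Definition _ d (g : tens d) :=
  GRing.isLinear.Build k (tens d) k^o *:%R (pairing g) (@pairing_is_linear d g).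

Lemma tens_words d (f : tens d) : f = \sum_w f w *: tword k w.
Proof.
apply/ffunP => u; rewrite sum_ffunE (bigD1 u) //= big1 ?addr0 => [|w wu].
  by rewrite !ffunE eqxx /GRing.scale /= mulr1.
by rewrite !ffunE eq_sym (negbTE wu) scaler0.
Qed.

Lemma sum_tword d (w : d.-tuple 'I_n) (F : d.-tuple 'I_n -> k) :
  \sum_u tword k w u * F u = F w.
Proof.
rewrite (bigD1 w) //= big1 ?addr0 => [|u uw].
  by rewrite ffunE eqxx mul1r.
by rewrite ffunE (negbTE uw) mul0r.
Qed.

Lemma tpair_tword d (w : d.-tuple 'I_n) (g : tens d) :
  tpair (tword k w) g = g w.
Proof. exact: (sum_tword w g). Qed.

Lemma tpair_tmul i j d (a : tens i) (b : tens j) (g : tens d) :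
  tpair (tmul d a b) g = \sum_u a u * \sum_v b v * evw g (u ++ v).
Proof.
rewrite /tpair; under eq_bigr do rewrite ffunE mulr_suml.
rewrite exchange_big; apply: eq_bigr => u _ /=.
under eq_bigr do rewrite mulr_suml big_mkcond.
rewrite exchange_big mulr_sumr; apply: eq_bigr => v _ /=.
by rewrite -big_mkcond -mulr_sumr evw_sum mulrA.
Qed.

Lemma tpair_tmul3 i j m d (a : tens i) (q : tens m) (b : tens j) (g : tens d) :
  tpair (tmul d (tmul (i + m) a q) b) g =
    \sum_v b v * \sum_u a u * \sum_t q t * evw g (u ++ t ++ v).
Proof.
rewrite tpair_tmul; under eq_bigr do rewrite mulr_sumr.
rewrite exchange_big; apply: eq_bigr => v _ /=.
pose h : tens (i + m) := [ffun s : (i + m).-tuple 'I_n => evw g (s ++ v)].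
have -> : \sum_u a u * \sum_t q t * evw g (u ++ t ++ v)
    = tpair (tmul (i + m) a q) h.
  rewrite tpair_tmul; apply: eq_bigr => u _; congr (_ * _).
  apply: eq_bigr => t _; congr (_ * _).
  by rewrite (evw_ffun (fun s => evw g (s ++ v))) ?size_cat ?size_tuple ?catA.
rewrite mulr_sumr; apply: eq_bigr => s _; rewrite [h s]ffunE.
by rewrite mulrCA.
Qed.

(** If g were not in W, some coordinate of the projection modulo W would be
    a functional vanishing on W but not at g. *)
Lemma double_orth d (W : {vspace tens d}) (g : tens d) :
  (forall f, (forall h, h \in W -> tpair f h = 0) -> tpair f g = 0) -> g \in W.
Proof.
move=> hg; rewrite -qproj_eq0; apply/eqP.
rewrite (coord_vbasis (memvf (qproj W g))) big1 // => s _.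
(* the s-th coordinate of qproj W, as a tensor *)
pose f : tens d := [ffun w => coord (vbasis fullv) s (qproj W (tword k w))].
have fE h : tpair f h = coord (vbasis fullv) s (qproj W h).
  rewrite {2}(tens_words h) !linear_sum; apply: eq_bigr => w _.
  by rewrite !linearZ /= ffunE mulrC.
rewrite -fE hg ?scale0r // => h; rewrite -qproj_eq0 => /eqP h0.
by rewrite fE h0 linear0.
Qed.

Lemma evw_linear_sum d (I : Type) (r : seq I) (P : pred I) (c : I -> k)
    (g : I -> tens d) w :
  evw (\sum_(i <- r | P i) c i *: g i) w =
    \sum_(i <- r | P i) c i * evw (g i) w.
Proof.
have [hw|hw] := boolP (size w == d); last first.
  by rewrite evw_size // big1 // => i _; rewrite evw_size ?mulr0.
rewrite (evwE _ (Tuple hw)) sum_ffunE; apply: eq_bigr => i _.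
by rewrite (evwE _ (Tuple hw)) ffunE.
Qed.

Lemma tpairC d (f g : tens d) : tpair f g = tpair g f.
Proof. by apply: eq_bigr => w _; rewrite mulrC. Qed.

Lemma tpair_linear_sum d (I : Type) (r : seq I) (P : pred I) (c : I -> k)
    (g : I -> tens d) f :
  tpair (\sum_(i <- r | P i) c i *: g i) f =
    \sum_(i <- r | P i) c i * tpair (g i) f.
Proof.
rewrite -[LHS]/(pairing f _) linear_sum; apply: eq_bigr => i _.
by rewrite linearZ.
Qed.

Lemma sum_tuple_cons d (V : nmodType) (F : seq 'I_n -> V) :
  \sum_(t : d.+1.-tuple 'I_n) F t = \sum_i \sum_(t : d.-tuple 'I_n) F (i :: t).
Proof.
rewrite pair_big /=.
rewrite (reindex (fun x : 'I_n * d.-tuple 'I_n => [tuple of x.1 :: x.2])) //=.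
exists (fun t : d.+1.-tuple 'I_n => (thead t, [tuple of behead t])).
  by move=> [i t] _ /=; rewrite theadE; congr (_, _); apply/val_inj.
by move=> t _; rewrite /= [RHS]tuple_eta.
Qed.

Lemma sum_tuple0 (V : nmodType) (F : seq 'I_n -> V) :
  \sum_(t : 0.-tuple 'I_n) F t = F [::].
Proof.
rewrite (bigD1 [tuple]) //= big1 ?addr0 // => t /eqP[].
exact: tuple0.
Qed.

(** The tensor \sum_i x_i (x) h_i. *)
Definition glue d (h : 'I_n -> tens d) : tens d.+1 :=
  [ffun w : d.+1.-tuple 'I_n => evw (h (thead w)) (behead w)].

Lemma evw_glue d (h : 'I_n -> tens d) i w : evw (glue h) (i :: w) = evw (h i) w.
Proof.
have [hw|hw] := boolP (size w == d); last by rewrite !evw_size.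
by rewrite -[i :: w]/(val [tuple of i :: Tuple hw]) evwE ffunE theadE.
Qed.

End Words.

(** * Functionals on B as tensors *)

Section DualTensors.
Variables (k : fieldType) (n : nat) (A : comAlgType k).
Variable pi : {lrmorphism {mpoly k[n]} -> A}.
Variables (p : nat) (l : 'I_p -> tens k n 1).
Local Notation tens := (tens k n).
Local Notation orth := (orth_ideal pi).
Local Notation van := (vanishing_left_ideal pi l).
Local Notation Bdual := (Bdual pi l).

(** Orthogonality to the two-sided ideal generated by Q^perp, tested on the
    products u q v with u and v words. *)
Definition quad_killed d (g : tens d) := forall (u v : seq 'I_n) q,
  q \in quadrics_orth pi -> \sum_t q t * evw g (u ++ t ++ v) = 0.

(** Orthogonality to the left ideal generated by the forms that vanish on
    l_1, ..., l_p, tested on the products u f with u a word. *)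
Definition form_killed d (g : tens d) := forall (u : seq 'I_n) f,
  (forall j, tpair f (l j) = 0) -> \sum_t f t * evw g (u ++ t) = 0.

Definition bcls d (f : tens d) : Bmod pi l d :=
  qproj (van d) (qproj (orth d) f).

Lemma bcls_is_linear d : linear (@bcls d).
Proof. by move=> c f g; rewrite /bcls !linearP. Qed.
HB.instance Definition _ d :=
  GRing.isLinear.Build k (tens d) (Bmod pi l d) *:%R
    (@bcls d) (@bcls_is_linear d).

Lemma bcls_repr d (b : Bmod pi l d) : bcls (qrepr (qrepr b)) = b.
Proof. by rewrite /bcls !qreprK. Qed.

Definition theta d (phi : Bdual d) : tens d :=
  [ffun w => phi (bcls (tword k w))].

Lemma thetaP d (phi : Bdual d) f : phi (bcls f) = tpair f (theta phi).
Proof.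
rewrite {1}(tens_words f) !linear_sum; apply: eq_bigr => w _.
by rewrite !linearZ /= ffunE.
Qed.

Lemma theta_is_linear d : linear (@theta d).
Proof.
by move=> c phi psi; apply/ffunP => w; rewrite !ffunE add_lfunE scale_lfunE.
Qed.
HB.instance Definition _ d :=
  GRing.isLinear.Build k (Bdual d) (tens d) *:%R
    (@theta d) (@theta_is_linear d).

Lemma theta_inj d : injective (@theta d).
Proof.
by move=> phi psi e; apply/lfunP => b; rewrite -(bcls_repr b) !thetaP e.
Qed.

Lemma orth_quad_killed d (g : tens d) : quad_killed g ->
  forall f, f \in orth d -> tpair f g = 0.
Proof.
move=> hg; apply: (spanP_ker (h := pairing g)).
move=> _ [i [j [a [q [b [_ hq ->]]]]]].
rewrite /= /pairing tpair_tmul3 big1 // => v _.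
by rewrite big1 ?mulr0 // => u _; rewrite hg ?mulr0.
Qed.

(** Against a tensor killed by Q^perp, the chosen representative of a class
    of the quadratic dual can be replaced by any other one.  Products of classes
    are always paired in this way, which avoids the associativity of tmul. *)
Lemma tpair_repr_orth d (g f : tens d) : quad_killed g ->
  tpair (qrepr (qproj (orth d) f)) g = tpair f g.
Proof.
move=> /orth_quad_killed /(_ _ (qrepr_qproj (orth d) f)) h.
apply/eqP; rewrite eq_sym -subr_eq0; apply/eqP; rewrite -[RHS]h.
exact/esym/(linearB (pairing g)).
Qed.

(** The ideal of relations starts in degree 2. *)
Lemma repr_orth1 (f : tens 1) : qrepr (qproj (orth 1) f) = f.
Proof.
apply/eqP; rewrite eq_sym -subr_eq0 -memv0.
have := qrepr_qproj (orth 1) f; apply/subvP.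
case: (spanPP (fun f => exists i j (a : tens i) q (b : tens j),
    [/\ (i + 2 + j)%N = 1%N, q \in quadrics_orth pi
      & f = tmul 1 (tmul (i + 2) a q) b])) => _; apply => v.
by case=> i [j [a [q [b [/eqP]]]]]; rewrite addnAC addn2.
Qed.

Lemma theta_quad_killed d (phi : Bdual d) : quad_killed (theta phi).
Proof.
move=> u v q hq; have [hd|hd] := eqVneq (size u + 2 + size v)%N d; last first.
  rewrite big1 // => t _; rewrite evw_size ?mulr0 // !size_cat size_tuple.
  by rewrite addnA.
pose f := tmul d (tmul (size u + 2) (tword k (in_tuple u)) q)
  (tword k (in_tuple v)).
have : f \in orth d.
  apply: (spanPP _).1; exists (size u), (size v), (tword k (in_tuple u)), q.
  by exists (tword k (in_tuple v)).
rewrite -qproj_eq0 => /eqP f0.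
have := thetaP phi f; rewrite /bcls f0 !linear0.
by rewrite /f tpair_tmul3 !sum_tword.
Qed.

(** Contraction of the last letter with f, the adjoint of right
    multiplication by f (tpair_tmul_contract). *)
Definition contract i d (g : tens d) (f : tens 1) : tens i :=
  [ffun v : i.-tuple 'I_n => \sum_t f t * evw g (v ++ t)].

Lemma evw_contract i d (g : tens d) f s : size s = i ->
  evw (contract i g f) s = \sum_t f t * evw g (s ++ t).
Proof. by move=> /eqP hs; rewrite (evwE _ (Tuple hs)) ffunE. Qed.

(** The contraction leaves the letters before the last one free to
    meet Q^perp. *)
Lemma contract_quad_killed i d (g : tens d) f :
  quad_killed g -> quad_killed (contract i g f).
Proof.
move=> hg u v q hq.
have [hi|hi] := eqVneq (size u + 2 + size v)%N i; last first.
  rewrite big1 // => t _; rewrite evw_size ?mulr0 // !size_cat size_tuple.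
  by rewrite addnA.
under eq_bigr => t _.
  rewrite evw_contract; last first.
    by rewrite !size_cat size_tuple addnA.
  rewrite mulr_sumr.
  under eq_bigr => s _ do rewrite -!catA mulrCA.
  over.
rewrite exchange_big big1 // => s _ /=.
by rewrite -mulr_sumr hg // mulr0.
Qed.

Lemma tpair_tmul_contract i d (a : tens i) f (g : tens d) :
  tpair (tmul d a f) g = tpair a (contract i g f).
Proof. by rewrite tpair_tmul; apply: eq_bigr => u _; rewrite ffunE. Qed.

(** The generators of L are products of a chosen representative with f;
    moving f to the other side of the pairing by adjunction allows the
    representative to be changed into the word u. *)
Lemma theta_form_killed d (phi : Bdual d) : form_killed (theta phi).
Proof.
move=> u f hf; have [hd|hd] := eqVneq (size u + 1)%N d; last first.
  rewrite big1 // => t _; rewrite evw_size ?mulr0 // size_cat size_tuple //.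
pose x := qproj (orth (size u)) (tword k (in_tuple u)).
have : qdmul d x (qproj (orth 1) f) \in van d.
  by apply: (spanPP _).1; exists (size u), x, f; split.
rewrite -qproj_eq0 /qdmul repr_orth1 => /eqP /(congr1 phi).
rewrite linear0 -/(bcls _) thetaP tpair_tmul_contract tpair_repr_orth.
  by rewrite tpair_tword ffunE.
exact/contract_quad_killed/theta_quad_killed.
Qed.

(** On the generators of L the pairing unfolds to form_killed, up to the
    choice of representatives settled by quad_killed. *)
Lemma tpair_bcls0 d (g : tens d) : quad_killed g -> form_killed g ->
  forall f, bcls f = 0 -> tpair f g = 0.
Proof.
move=> hq hf f /eqP; rewrite /bcls qproj_eq0 -(tpair_repr_orth f hq).
apply: (spanP_ker (h := pairing g \o @qrepr _ _ (orth d))).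
move=> _ [i [a [u [_ hu ->]]]].
rewrite /= /pairing /qdmul (tpair_repr_orth _ hq) repr_orth1 tpair_tmul.
rewrite big1 // => v _.
by rewrite hf ?mulr0.
Qed.

Lemma tpair_repr d (g f : tens d) : quad_killed g -> form_killed g ->
  tpair (qrepr (qrepr (bcls f))) g = tpair f g.
Proof.
move=> hq hf; apply/eqP; rewrite -subr_eq0; apply/eqP.
have <- := linearB (pairing g); apply: tpair_bcls0 => //.
by rewrite linearB /= bcls_repr subrr.
Qed.

Lemma theta_onto d (g : tens d) : quad_killed g -> form_killed g ->
  exists phi : Bdual d, theta phi = g.
Proof.
move=> hq hf.
exists (linfun (pairing g \o @qrepr _ _ (orth d) \o @qrepr _ _ (van d))).
by apply/ffunP => w; rewrite ffunE lfunE /= /pairing tpair_repr // tpair_tword.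
Qed.

(** On tensors, x_i^* acts by reading off the first letter: left
    multiplication by x_i^* puts the letter i in front of a word. *)
Lemma theta_act d (phi : Bdual d.+1) i w :
  evw (theta (Bdual_act d phi (xstar pi i))) w = evw (theta phi) (i :: w).
Proof.
have [hw|hw] := eqVneq (size w) d; last by rewrite !evw_size.
have {hw} hw : size w == d by apply/eqP.
rewrite (evwE _ (Tuple hw)) ffunE Bdual_actE.
rewrite /Bact /qdmul -/(bcls _) thetaP repr_orth1 tpair_tmul sum_tword.
pose g : tens d := [ffun v : d.-tuple 'I_n => evw (theta phi) (i :: v)].
have gE s : evw g s = evw (theta phi) (i :: s).
  have [hs|hs] := eqVneq (size s) d; last by rewrite !evw_size.
  exact: (evw_ffun (fun v => evw (theta phi) (i :: v))).
transitivity (tpair (qrepr (qrepr (bcls (tword k (Tuple hw))))) g).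
  by apply: eq_bigr => v _; rewrite ffunE.
rewrite tpair_repr ?tpair_tword ?ffunE //.
  move=> u v q hq; under eq_bigr do rewrite gE -cat_cons.
  exact: theta_quad_killed.
move=> u f hf; under eq_bigr do rewrite gE -cat_cons.
exact: theta_form_killed.
Qed.

End DualTensors.

(** * Linear rows in the complex attached to the forms *)

(** A k-matrix with independent rows has a right inverse over k, which
    is still a right inverse over A. *)
Lemma row_free_in_alg (k : fieldType) (A : comAlgType k) m r
    (P : 'M[k]_(m, r)) :
    (forall c : 'rV[k]_m, c *m P = 0 -> c = 0) ->
  forall v : 'rV[A]_m, v *m map_mx (in_alg A) P = 0 -> v = 0.
Proof.
move=> hP v v0; have freeP : row_free P.
  rewrite -kermx_eq0; apply/eqP/row_matrixP => i.
  by rewrite row0; apply: hP; rewrite -row_mul mulmx_ker row0.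
rewrite -[v]mulmx1 -(map_mx1 (in_alg A)) -(mulmxVp freeP) map_mxM mulmxA v0.
by rewrite mul0mx.
Qed.

Section DualComplex.
Variables (k : fieldType) (n : nat) (A : comAlgType k).
Variable pi : {lrmorphism {mpoly k[n]} -> A}.
Hypothesis hA : standard_graded pi.
Variables (p : nat) (l : 'I_p -> tens k n 1).
Local Notation tens := (tens k n).
Local Notation gen := (gen pi).
Local Notation piece := (graded_piece pi).
Local Notation Bdual := (Bdual pi l).
Local Notation K := (dual_complex pi l).
Local Notation bas d s := ((vbasis {: Bdual d})`_s).
Local Notation "c ^A" := (map_mx (in_alg A) c) (at level 2, format "c ^A").

Lemma tev_is_linear d : linear (@tev _ _ _ pi d).
Proof.
move=> c f g; rewrite /tev scaler_sumr -big_split; apply: eq_bigr => w _.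
by rewrite !ffunE scalerDl scalerA.
Qed.
HB.instance Definition _ d :=
  GRing.isLinear.Build k (tens d) A *:%R (@tev _ _ _ pi d) (@tev_is_linear d).

Lemma tev1 (g : tens 1) : tev pi g = \sum_i evw g [:: i] *: gen i.
Proof.
rewrite /tev; under eq_bigr do rewrite -evwE.
rewrite (sum_tuple_cons _ (fun w => evw g w *: \prod_(i <- w) gen i)).
apply: eq_bigr => i _.
rewrite (sum_tuple0 (fun w => evw g (i :: w) *: \prod_(j <- i :: w) gen j)).
by rewrite big_seq1.
Qed.

Lemma tev2 (g : tens 2) :
  tev pi g = \sum_i \sum_j evw g [:: i; j] *: (gen i * gen j).
Proof.
rewrite /tev; under eq_bigr do rewrite -evwE.
rewrite (sum_tuple_cons _ (fun w => evw g w *: \prod_(i <- w) gen i)).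
apply: eq_bigr => i _.
rewrite (sum_tuple_cons _
  (fun w => evw g (i :: w) *: \prod_(i <- i :: w) gen i)).
apply: eq_bigr => j _.
rewrite (sum_tuple0 (fun w => evw g [:: i, j & w] *:
  \prod_(m <- [:: i, j & w]) gen m)).
by rewrite big_cons big_seq1.
Qed.

Lemma quadricsP (h : tens 2) : h \in quadrics pi <-> tev pi h = 0.
Proof.
apply: spanP_linear => [|a u v u0 v0]; first exact: linear0.
by rewrite linearP /= u0 v0 scaler0 addr0.
Qed.

Lemma quadrics_orthP (f : tens 2) :
  f \in quadrics_orth pi <-> forall g, g \in quadrics pi -> tpair f g = 0.
Proof.
apply: spanP_linear => [g _|a u v hu hv g hg].
  exact: (linear0 (pairing g)).
apply: etrans (linearP (pairing g) _ _ _) _.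
by rewrite /= /pairing hu // hv // scaler0 addr0.
Qed.

(** By double orthogonality, the first two letters of g lie in Q_2. *)
Lemma quad_killed_tev d (g : tens d) w : quad_killed pi g ->
  \sum_i \sum_j evw g [:: i, j & w] *: (gen i * gen j) = 0.
Proof.
move=> hg; pose h : tens 2 := [ffun t : 2.-tuple 'I_n => evw g (t ++ w)].
have -> : \sum_i \sum_j evw g [:: i, j & w] *: (gen i * gen j) = tev pi h.
  rewrite tev2; apply: eq_bigr => i _; apply: eq_bigr => j _.
  by rewrite (evw_ffun (fun t => evw g (t ++ w))).
apply/quadricsP/double_orth => f /quadrics_orthP hf.
by rewrite -[RHS](hg [::] w f hf); apply: eq_bigr => t _; rewrite ffunE.
Qed.

Lemma tev_quad_killed d (g : tens d) w q : q \in quadrics_orth pi ->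
    \sum_i \sum_j evw g [:: i, j & w] *: (gen i * gen j) = 0 ->
  \sum_t q t * evw g (t ++ w) = 0.
Proof.
move=> /quadrics_orthP hq h0.
pose h : tens 2 := [ffun t : 2.-tuple 'I_n => evw g (t ++ w)].
have <- : tpair q h = \sum_t q t * evw g (t ++ w).
  by apply: eq_bigr => t _; rewrite ffunE.
apply/hq/quadricsP; rewrite tev2 -[RHS]h0.
apply: eq_bigr => i _; apply: eq_bigr => j _.
by rewrite (evw_ffun (fun t => evw g (t ++ w))).
Qed.

Definition vec d (c : 'rV[k]_(rk K d)) : Bdual d := \sum_s c 0 s *: bas d s.

Lemma coord_vec d (phi : Bdual d) :
  vec (\row_s coord (vbasis {: Bdual d}) s phi) = phi.
Proof.
rewrite [RHS](coord_vbasis (memvf phi)); apply: eq_bigr => s _.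
by rewrite mxE.
Qed.

Lemma vec_eq0 d (c : 'rV[k]_(rk K d)) : vec c = 0 -> c = 0.
Proof.
move=> c0; apply/rowP => s; rewrite mxE.
have := coord_sum_free (c 0) s (basis_free (vbasisP {: Bdual d})).
by rewrite -/(vec c) c0 linear0.
Qed.

Lemma evw_theta_vec d (c : 'rV[k]_(rk K d)) w :
  evw (theta (vec c)) w = \sum_s c 0 s * evw (theta (bas d s)) w.
Proof.
rewrite /vec linear_sum; under eq_bigr do rewrite linearZ /=.
exact: evw_linear_sum.
Qed.

(** The coefficient of the word w in the image of r under the embedding of
    A (x) B_d^* into A (x) V^(x)d. *)
Definition tensor d (r : 'rV[A]_(rk K d)) (w : seq 'I_n) : A :=
  \sum_(s < rk K d) evw (theta (bas d s)) w *: r 0 s.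

Lemma tensor_scalar d (c : 'rV[k]_(rk K d)) w :
  tensor c^A w = (evw (theta (vec c)) w)%:A.
Proof.
rewrite evw_theta_vec scaler_suml; apply: eq_bigr => s _.
by rewrite mxE /= scalerA mulrC.
Qed.

(** The tensors of a basis of B_d^* are independent over k, hence over A. *)
Lemma tensor_inj d (r r' : 'rV[A]_(rk K d)) : tensor r =1 tensor r' -> r = r'.
Proof.
move=> e; apply/eqP; rewrite -subr_eq0; apply/eqP.
pose P := \matrix_(s < rk K d, j < #|{: d.-tuple 'I_n}|)
  evw (theta (bas d s)) (enum_val j).
apply: (@row_free_in_alg _ _ _ _ P) => [c c0|].
  apply/vec_eq0/theta_inj/ffunP => w.
  rewrite linear0 -evwE evw_theta_vec [RHS]ffunE.
  have := congr1 (fun M : 'rV_ _ => M 0 (enum_rank w)) c0.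
  rewrite /= [X in X = _]mxE [X in _ = X]mxE => h; rewrite -[RHS]h.
  by apply: eq_bigr => s _; rewrite mxE enum_rankK.
apply/rowP => j; rewrite [RHS]mxE -(subrr (tensor r (enum_val j))) {2}e.
rewrite /tensor -sumrB mxE; apply: eq_bigr => s _.
by rewrite !mxE /= -scalerBr mulrC mulr_algl.
Qed.

(** The differential is  f |-> (w |-> \sum_i x_i f(i w))  on functions from
    words to A. *)
Lemma tensor_df d (r : 'rV[A]_(rk K d.+1)) w :
  tensor (r *m df K d) w = \sum_i gen i * tensor r (i :: w).
Proof.
rewrite /tensor; under eq_bigr => t _.
  rewrite mxE scaler_sumr; under eq_bigr => s _.
    rewrite mxE mulr_sumr scaler_sumr.
    over.
  over.
rewrite exchange_big /= [RHS](eq_bigr _ (fun i _ => mulr_sumr _ _ _ _)).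
rewrite [RHS]exchange_big; apply: eq_bigr => s _ /=.
rewrite exchange_big; apply: eq_bigr => i _ /=.
rewrite -theta_act.
set phi := Bdual_act _ _ _; rewrite {2}(coord_vbasis (memvf phi)) linear_sum.
under [X in evw X]eq_bigr do rewrite linearZ /=.
rewrite evw_linear_sum scaler_suml mulr_sumr; apply: eq_bigr => t _.
by rewrite -!scalerAr scalerA mulrC [gen i * _]mulrC.
Qed.

(** Applying the differential twice multiplies the first two letters in A,
    and they lie in Q_2. *)
Lemma df_df d (r : 'rV[A]_(rk K d.+2)) : r *m df K d.+1 *m df K d = 0.
Proof.
apply: tensor_inj => w; rewrite tensor_df.
rewrite [RHS]big1 => [|t _]; last by rewrite mxE scaler0.
under eq_bigr do rewrite tensor_df mulr_sumr.
rewrite exchange_big /=.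
transitivity (\sum_(s < rk K d.+2) (\sum_j \sum_i
    evw (theta (bas d.+2 s)) [:: j, i & w] *: (gen j * gen i)) * r 0 s).
  under [RHS]eq_bigr do rewrite mulr_suml.
  rewrite [RHS]exchange_big; apply: eq_bigr => j _ /=.
  under [RHS]eq_bigr do rewrite mulr_suml.
  rewrite [RHS]exchange_big; apply: eq_bigr => i _ /=.
  rewrite /tensor !mulr_sumr; apply: eq_bigr => s _.
  by rewrite -!scalerAr -scalerAl mulrCA mulrA.
rewrite big1 // => s _.
by rewrite quad_killed_tev ?mul0r //; apply: theta_quad_killed.
Qed.

(** The x_i are independent in A, so a tensor of positive degree with
    \sum_i x_i f(i w) = 0 for all w vanishes. *)
Lemma df_scalar_inj d (c : 'rV[k]_(rk K d.+1)) : c^A *m df K d = 0 -> c = 0.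
Proof.
move=> c0; apply/vec_eq0/theta_inj/ffunP => t; rewrite linear0 [RHS]ffunE.
have /(gen_free hA)/(_ (thead t)) : \sum_i
    evw (theta (vec c)) (i :: behead t) *: gen i = 0.
  rewrite -[RHS](_ : tensor (c^A *m df K d) (behead t) = 0).
    rewrite tensor_df; apply: eq_bigr => i _.
    by rewrite tensor_scalar -scalerAr mulr1.
  by rewrite c0 /tensor big1 // => s _; rewrite mxE scaler0.
by move=> h; rewrite -evwE (tuple_eta t).
Qed.

(** The rows with entries in A_1, written on the basis of the x_i. *)
Definition linear_row m (C : 'I_n -> 'rV[k]_m) : 'rV[A]_m :=
  \sum_i gen i *: (C i)^A.

Lemma linear_rowE m (C : 'I_n -> 'rV[k]_m) t :
  linear_row C 0 t = \sum_i C i 0 t *: gen i.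
Proof.
rewrite summxE; apply: eq_bigr => i _.
by rewrite !mxE /= -scalerAr mulr1.
Qed.

Lemma linear_rowP m (v : 'rV[A]_m) :
  (forall t, piece 1 (v 0 t)) -> exists C, v = linear_row C.
Proof.
move=> hv; have [C hC] := fin_all_exists (fun t => piece1P (hv t)).
exists (fun i => \row_t C t i); apply/rowP => t; rewrite linear_rowE hC.
by apply: eq_bigr => i _; rewrite mxE.
Qed.

Lemma df_linear d (c : 'rV[k]_(rk K d.+1)) :
  exists C, c^A *m df K d = linear_row C.
Proof.
apply: linear_rowP => t; rewrite mxE; apply: piece_sum => s _.
rewrite !mxE -scalerAl mul1r; apply/pieceZ/piece1_linear.
Qed.

Lemma tensor_linear_row d (C : 'I_n -> 'rV[k]_(rk K d)) w :
  tensor (linear_row C) w = \sum_i evw (theta (vec (C i))) w *: gen i.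
Proof.
rewrite /tensor; under eq_bigr do rewrite linear_rowE scaler_sumr.
rewrite exchange_big; apply: eq_bigr => i _ /=.
rewrite evw_theta_vec scaler_suml; apply: eq_bigr => s _.
by rewrite scalerA mulrC.
Qed.

(** A row \sum_i x_i (x) psi_i comes from the functional whose tensor is
    obtained by putting the letter i in front of psi_i, if there is one. *)
Lemma glue_df d (C : 'I_n -> 'rV[k]_(rk K d)) :
    quad_killed pi (glue (fun i => theta (vec (C i)))) ->
    form_killed l (glue (fun i => theta (vec (C i)))) ->
  exists c : 'rV[k]_(rk K d.+1), linear_row C = c^A *m df K d.
Proof.
move=> hq hf; have [phi hphi] := theta_onto hq hf.
exists (\row_s coord (vbasis {: Bdual d.+1}) s phi).
apply: tensor_inj => w; rewrite tensor_df tensor_linear_row.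
apply: eq_bigr => i _.
by rewrite tensor_scalar coord_vec hphi evw_glue -scalerAr mulr1.
Qed.

(** For the glued tensor all conditions that avoid the first letter are
    inherited from the psi_i; the remaining one, on the first two letters, is
    the hypothesis that the product in A_2 vanishes. *)
Lemma df_linear_exact d (C : 'I_n -> 'rV[k]_(rk K d.+1)) :
    linear_row C *m df K d = 0 ->
  exists c : 'rV[k]_(rk K d.+2), linear_row C = c^A *m df K d.+1.
Proof.
move=> C0; apply: glue_df => [[|i u] v q hq|[|i u] f hf].
- apply: tev_quad_killed => //.
  rewrite -[RHS](_ : tensor (linear_row C *m df K d) v = 0); last first.
    by rewrite C0 /tensor big1 // => s _; rewrite mxE scaler0.
  rewrite tensor_df exchange_big; apply: eq_bigr => j _ /=.
  rewrite tensor_linear_row mulr_sumr; apply: eq_bigr => i _.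
  by rewrite evw_glue -scalerAr mulrC.
- under eq_bigr do rewrite cat_cons evw_glue.
  exact: theta_quad_killed.
- by rewrite big1 // => t _; rewrite evw_size ?mulr0 // size_tuple.
under eq_bigr do rewrite cat_cons evw_glue.
exact: theta_form_killed.
Qed.

Lemma augment_tensor (r : 'rV[A]_(rk K 0)) :
  augment (@dual_augmentation _ _ _ pi _ l) r = tensor r [::].
Proof.
apply: eq_bigr => s _; rewrite mulrC mulr_algl; congr (_ *: _).
by rewrite -[[::]]/(val [tuple]) evwE ffunE.
Qed.

Lemma linform_tev (b : 'I_p -> k) :
  ideal_gen (linform pi l) (tev pi (\sum_j b j *: l j)).
Proof.
exists (fun j => (b j)%:A); rewrite linear_sum; apply: eq_bigr => j _.
by rewrite linearZ /= mulr_algl.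
Qed.

Lemma piece_linform j : piece 1 (linform pi l j).
Proof. by rewrite /linform tev1; apply: piece1_linear. Qed.

Lemma linform_piece1 a : piece 1 a -> ideal_gen (linform pi l) a ->
  exists b : 'I_p -> k, a = tev pi (\sum_j b j *: l j).
Proof.
move=> ha [c ac].
have [b hb] := fin_all_exists (fun j => piece0P (hcomp_piece pi 0 (c j))).
exists b; rewrite -(hcomp_id hA ha) ac (hcomp_sum hA) linear_sum.
apply: eq_bigr => j _.
by rewrite (hcompM hA _ _ (piece_linform j)) hb linearZ /= mulr_algl.
Qed.

(** B_1^* is the span of l_1, ..., l_p, by double orthogonality; and a
    linear form in the ideal is a k-combination of the l_j, by taking components
    of degree 1. *)
Lemma df0_linear_exact (C : 'I_n -> 'rV[k]_(rk K 0)) :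
  ideal_gen (linform pi l) (tensor (linear_row C) [::]) <->
  exists c : 'rV[k]_(rk K 1), linear_row C = c^A *m df K 0.
Proof.
split=> [|[c ->]].
  rewrite tensor_linear_row => /linform_piece1-/(_ (piece1_linear pi _))[b hb].
  set g := \sum_j b j *: l j in hb.
  have gE i : evw (theta (vec (C i))) [::] = evw g [:: i].
    move/eqP: hb; rewrite tev1 -subr_eq0 -sumrB.
    under eq_bigr do rewrite -scalerBl.
    by move=> /eqP/(gen_free hA)/(_ i)/eqP; rewrite subr_eq0 => /eqP.
  apply: glue_df => [u v q _|[|i u] f hf].
  - rewrite big1 // => t _; rewrite evw_size ?mulr0 // !size_cat size_tuple.
    by rewrite addnCA addSn.
  - rewrite -[RHS](_ : tpair f g = 0); last first.
      rewrite tpairC tpair_linear_sum big1 // => j _.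
      by rewrite tpairC hf mulr0.
    apply: eq_bigr => t _; congr (_ * _); rewrite -evwE (tuple_eta t) /=.
    have -> : behead t = [::].
      by apply: size0nil; rewrite size_behead size_tuple.
    by rewrite evw_glue gE.
  - rewrite big1 // => t _; rewrite evw_size ?mulr0 // size_cat size_tuple.
    by rewrite /= addn1.
pose W := (\sum_j <[l j]>)%VS.
have /memv_sumP[x hx thetaE] : theta (vec c) \in W.
  apply: double_orth => f hf.
  have fl j : tpair f (l j) = 0 by apply: hf; rewrite memvE (sumv_sup j).
  rewrite -[RHS](theta_form_killed (vec c) [::] fl).
  by apply: eq_bigr => t _; rewrite evwE.
have [b hb] := fin_all_exists (fun j => elimT (vlineP _ _) (hx j isT)).
have -> : tensor (c^A *m df K 0) [::] = tev pi (theta (vec c)).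
  rewrite tensor_df tev1; apply: eq_bigr => i _.
  by rewrite tensor_scalar -scalerAr mulr1.
rewrite thetaE (eq_bigr _ (fun j _ => hb j)); exact: linform_tev.
Qed.

Lemma vec0_onto (x : k) :
  exists c : 'rV[k]_(rk K 0), evw (theta (vec c)) [::] = x.
Proof.
pose g : tens 0 := [ffun=> x].
have [|u f hf|phi hphi] := @theta_onto _ _ _ pi _ l _ g.
- move=> u v q _; rewrite big1 // => t _; rewrite evw_size ?mulr0 //.
  by rewrite !size_cat size_tuple addnCA.
- rewrite big1 // => t _; rewrite evw_size ?mulr0 // size_cat size_tuple.
  by rewrite addn1.
exists (\row_s coord (vbasis {: Bdual 0}) s phi).
by rewrite coord_vec hphi -[[::]]/(val [tuple]) evwE ffunE.
Qed.

End DualComplex.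

(** * Comparison with a minimal resolution *)

Lemma dependent_chain (T : nat -> Type) (R : forall i, T i -> T i.+1 -> Prop)
    (x0 : T 0) : (forall i x, exists y, @R i x y) ->
  exists f : forall i, T i, f 0 = x0 /\ forall i, R i (f i) (f i.+1).
Proof.
move=> hR.
pose next i x := sval (constructive_indefinite_description _ (hR i x)).
pose f := fix f i : T i := if i is j.+1 then next j (f j) else x0.
exists f; split=> // i.
exact: (svalP (constructive_indefinite_description _ (hR i (f i)))).
Qed.

Section Comparison.
Variables (k : fieldType) (n : nat) (A : comAlgType k).
Variable pi : {lrmorphism {mpoly k[n]} -> A}.
Hypothesis hA : standard_graded pi.
Variables (p : nat) (l : 'I_p -> tens k n 1).
Local Notation gen := (gen pi).
Local Notation piece := (graded_piece pi).
Local Notation K := (dual_complex pi l).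
Local Notation "c ^A" := (map_mx (in_alg A) c) (at level 2, format "c ^A").

Lemma shifted_piece0 i j : shifted_piece pi i j 0.
Proof. by rewrite /shifted_piece; case: leqP => // _; apply: piece0. Qed.

Section MinimalComplex.
Variable G : gfcomplex A.
Hypothesis G_graded : forall i (a : 'I_(rk G i.+1)),
  component pi (dg a) (row a (df G i)).
Hypothesis G_exact : forall i (v : 'rV[A]_(rk G i.+1)),
  v *m df G i = 0 <-> exists w, v = w *m df G i.+1.
Hypothesis G_minimal : minimal pi G.

(** The space W_i of scalar combinations of the generators of degree i. *)
Definition supported i (w : 'rV[k]_(rk G i)) : Prop :=
  forall b, w 0 b != 0 -> dg b = i.

(** The kernel is the image of the next differential, which by minimality
    has entries in the maximal ideal. *)
Lemma scalar_ker i (w : 'rV[k]_(rk G i.+1)) : w^A *m df G i = 0 -> w = 0.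
Proof.
move=> /G_exact[u hu]; apply/rowP => b; rewrite mxE.
have := congr1 (fun M : 'rV_ _ => M 0 b) hu; rewrite /= !mxE /= => wb.
apply: (irrelevant_scalar hA); rewrite wb; apply: irrelevant_sum => a _.
exact/irrelevantM/G_minimal.
Qed.

Lemma df_entry i (a : 'I_(rk G i.+1)) b :
  shifted_piece pi (dg b) (dg a) (df G i a b).
Proof. by have := G_graded a b; rewrite mxE. Qed.

Lemma df_entry_lt i (a : 'I_(rk G i.+1)) b : df G i a b != 0 -> (dg b < dg a)%N.
Proof.
have := df_entry a b; rewrite /shifted_piece; case: ltngtP => // [_ ->|->].
  by rewrite eqxx.
by rewrite subnn => /(irrelevant_piece0 hA (G_minimal _ _)) ->; rewrite eqxx.
Qed.

(** By scalar_ker each row of the differential has a nonzero entry, and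
    nonzero entries lead to generators of smaller degree. *)
Lemma dg_ge i (b : 'I_(rk G i)) : (i <= dg b)%N.
Proof.
elim: i b => // i IH a.
have [b hb] : exists b, df G i a b != 0.
  apply: NNPP => hn; have : (delta_mx 0 a : 'rV[k]__) = 0.
    apply: scalar_ker; rewrite map_delta_mx -rowE; apply/rowP => b.
    rewrite !mxE; apply/eqP/negPn/negP => ab; apply: hn; by exists b.
  by move=> /matrixP/(_ 0 a)/eqP; rewrite !mxE !eqxx oner_eq0.
exact: leq_ltn_trans (IH b) (df_entry_lt hb).
Qed.

Lemma homogeneous_preimage i j (v : 'rV[A]_(rk G i)) u :
    component pi j v -> v = u *m df G i ->
  exists2 u', component pi j u' & v = u' *m df G i.
Proof.
move=> hv vE; exists (\row_b shcomp pi (dg b) j (u 0 b)).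
  by move=> b; rewrite mxE; apply: shcomp_piece.
apply/rowP => c; rewrite -(shcomp_id hA (hv c)) vE !mxE shcomp_sum //.
by apply: eq_bigr => b _; rewrite mxE (shcompM hA _ _ (df_entry b c)).
Qed.

Lemma component_bottom i (u : 'rV[A]_(rk G i)) : component pi i u ->
  exists2 w : 'rV[k]_(rk G i), u = w^A & supported w.
Proof.
move=> hu.
have /fin_all_exists[w hw] b :
    exists x : k, u 0 b = x%:A /\ (x != 0 -> dg b = i).
  have := hu b; rewrite /shifted_piece; case: (ltngtP (dg b) i) => [|_ ->|->].
  - by rewrite ltnNge dg_ge.
  - by exists 0; rewrite scale0r eqxx.
  by rewrite subnn => /piece0P[x ->]; exists x.
exists (\row_b w b); first by apply/rowP => b; rewrite !mxE (hw b).1.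
by move=> b; rewrite mxE => /(hw b).2.
Qed.

Lemma supported_component i (w : 'rV[k]_(rk G i)) :
  supported w -> component pi i w^A.
Proof.
move=> hw b; rewrite mxE /=; have [->|/hw ->] := eqVneq (w 0 b) 0.
  by rewrite scale0r; apply: shifted_piece0.
by rewrite /shifted_piece leqnn subnn; apply: piece_scalar.
Qed.

(** A generator of degree i + 1 maps to generators of degree at least i,
    and minimality excludes those of degree i + 1. *)
Lemma supported_df i (w : 'rV[k]_(rk G i.+1)) : supported w ->
  exists2 C, w^A *m df G i = linear_row pi C & forall j, supported (C j).
Proof.
move=> hw; set v := w^A *m df G i.
have hv b : piece 1 (v 0 b) /\ (v 0 b != 0 -> dg b = i).
  have [hb|hb] := eqVneq (dg b) i.
    split=> //; rewrite mxE; apply: piece_sum => a _; rewrite mxE /= mulr_algl.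
    have [->|/hw ha] := eqVneq (w 0 a) 0.
      by rewrite scale0r; apply: piece0.
    apply: pieceZ; have := df_entry a b.
    by rewrite ha hb /shifted_piece leqnSn subSnn.
  suff -> : v 0 b = 0 by rewrite eqxx; split=> //; apply: piece0.
  rewrite mxE big1 // => a _; rewrite mxE /= mulr_algl.
  have [->|/hw ha] := eqVneq (w 0 a) 0; first by rewrite scale0r.
  have [->|/df_entry_lt] := eqVneq (df G i a b) 0; first by rewrite scaler0.
  by rewrite ha ltnS leqNgt ltn_neqAle eq_sym hb dg_ge.
have [C vC] := linear_rowP (fun b => (hv b).1).
exists C => // j b hC; apply: (hv b).2; apply: contraNneq hC.
by rewrite vC linear_rowE => /(gen_free hA)/(_ j) ->.
Qed.

(** phi identifies B_i^* with W_i.  The last field compares what the next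
    step will be in both complexes: B_(i+1)^* and the linear boundaries of G. *)
Record strand_iso i (phi : 'M[k]_(rk K i, rk G i)) : Prop := StrandIso {
  si_supported : forall c, supported (c *m phi);
  si_inj : forall c : 'rV[k]__, c *m phi = 0 -> c = 0;
  si_onto : forall w, supported w -> exists c, w = c *m phi;
  si_linear : forall C,
    (exists u, linear_row pi C *m phi^A = u *m df G i) <->
    (exists c : 'rV[k]__, linear_row pi C = c^A *m df K i) }.

Lemma si_mono i (phi : 'M[k]_(rk K i, rk G i)) : strand_iso phi ->
  forall v v' : 'rV[A]__, v *m phi^A = v' *m phi^A -> v = v'.
Proof.
move=> hphi v v' e; apply/eqP; rewrite -subr_eq0; apply/eqP.
by apply: (row_free_in_alg (si_inj hphi)); rewrite mulmxBl e subrr.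
Qed.

(** The image under psi of a basis element of B_(i+1)^* is a homogeneous
    preimage of its boundary, transported to G by phi.  Conversely the boundary
    of an element of W_(i+1) is linear over W_i, so it comes from a linear row
    over B_i^*, which comes from B_(i+1)^*.  For psi, the last field
    compares cycles with cycles: the boundaries are the cycles in G by exactness,
    and among the linear rows over B_(i+1)^* by df_linear_exact. *)
Lemma strand_step i (phi : 'M[k]_(rk K i, rk G i)) : strand_iso phi ->
  exists2 psi : 'M[k]_(rk K i.+1, rk G i.+1),
    strand_iso psi & df K i *m phi^A = psi^A *m df G i.
Proof.
move=> hphi.
have supp_comp (c : 'rV[k]_(rk K i.+1)) :
    component pi i.+1 (c^A *m df K i *m phi^A).
  have [C ->] := df_linear c => b; rewrite mxE.
  have [hb|hb] := eqVneq (dg b) i; last first.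
    rewrite big1 => [|t _]; first exact: shifted_piece0.
    rewrite mxE /=; have [->|ne] := eqVneq (phi t b) 0.
      by rewrite scale0r mulr0.
    case/negP: hb; apply/eqP/(si_supported hphi (c := delta_mx 0 t)).
    by rewrite -rowE mxE.
  rewrite hb /shifted_piece leqnSn subSnn; apply: piece_sum => t _.
  rewrite mxE /= mulrC mulr_algl; apply: pieceZ.
  by rewrite linear_rowE; apply: piece1_linear.
have /fin_all_exists[W hW] s : exists w : 'rV[k]_(rk G i.+1),
    supported w /\ row s (df K i) *m phi^A = w^A *m df G i.
  have [C hC] := df_linear (delta_mx 0 s : 'rV[k]_(rk K i.+1)).
  have [u hu] : exists u, linear_row pi C *m phi^A = u *m df G i.
    by apply/(si_linear hphi); exists (delta_mx 0 s).
  have := supp_comp (delta_mx 0 s); rewrite hC => hcomp.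
  have [u' hu' uE] := homogeneous_preimage hcomp hu.
  have [w wE hw] := component_bottom hu'.
  by exists w; split=> //; rewrite -wE -uE -hC map_delta_mx -rowE.
pose psi : 'M[k]_(rk K i.+1, rk G i.+1) := \matrix_s W s.
have comm : df K i *m phi^A = psi^A *m df G i.
  apply/row_matrixP => s; rewrite !row_mul (hW s).2 -map_row.
  by congr (map_mx _ _ *m _); apply/rowP => b; rewrite !mxE.
have supp_psi c : supported (c *m psi).
  move=> b; apply: contraNeq => hb; rewrite mxE big1 // => s _; rewrite mxE.
  have [->|/(hW s).1 e] := eqVneq (W s 0 b) 0; first by rewrite mulr0.
  by rewrite e eqxx in hb.
exists psi => //; split=> // [c c0|w hw|C].
- apply: (df_scalar_inj hA (l := l)); apply: (si_mono hphi).
  by rewrite mul0mx -mulmxA comm mulmxA -map_mxM c0 map_mx0 mul0mx.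
- (* surjectivity: C is the boundary of w, and D its preimage under phi *)
  have [C hC suppC] := supported_df hw.
  have /fin_all_exists[D hD] j := si_onto hphi (suppC j).
  have DC : linear_row pi C = linear_row pi D *m phi^A.
    rewrite mulmx_suml; apply: eq_bigr => j _.
    by rewrite hD map_mxM scalemxAl.
  have [c hc] : exists c : 'rV[k]__, linear_row pi D = c^A *m df K i.
    by apply/(si_linear hphi); exists w^A; rewrite -DC hC.
  exists c; apply/eqP; rewrite -subr_eq0; apply/eqP/scalar_ker.
  by rewrite map_mxB mulmxBl hC DC hc map_mxM -mulmxA comm mulmxA subrr.
split=> [/G_exact|[c ->]].
  rewrite -mulmxA -comm mulmxA => C0; apply: df_linear_exact => //.
  by apply: (si_mono hphi); rewrite C0 mul0mx.
by apply/G_exact; rewrite -mulmxA -comm mulmxA df_df mul0mx.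
Qed.

Lemma strand_chain (phi0 : 'M[k]_(rk K 0, rk G 0)) : strand_iso phi0 ->
  exists phi : forall i, 'M[k]_(rk K i, rk G i),
  [/\ phi 0 = phi0, forall i, strand_iso (phi i)
    & forall i, df K i *m (phi i)^A = (phi i.+1)^A *m df G i].
Proof.
move=> h0; pose T i := {phi : 'M[k]_(rk K i, rk G i) | strand_iso phi}.
pose R i (x : T i) (y : T i.+1) := df K i *m (sval x)^A = (sval y)^A *m df G i.
have [i [phi hphi]|f [f0 fR]] := @dependent_chain T R (exist _ phi0 h0).
  by have [psi hpsi comm] := strand_step hphi; exists (exist _ psi hpsi).
exists (fun i => sval (f i)); split=> [|i|i]; first by rewrite f0.
  exact: (svalP (f i)).
exact: fR.
Qed.

End MinimalComplex.

Section Resolution.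
Variables (F : gfcomplex A) (e : 'I_(rk F 0) -> A).

(** The resolution of A/(l_1, ..., l_p) obtained from a resolution of the
    ideal. *)
Definition augmented : gfcomplex A :=
  {| rk i := if i is j.+1 then rk F j else 1;
     dg i := match i return 'I_(if i is j.+1 then rk F j else 1) -> nat with
             | 0 => fun _ => 0 | j.+1 => @dg _ _ F j end;
     df i := match i return 'M[A]_(rk F i, if i is j.+1 then rk F j else 1) with
             | 0 => \col_b e b | j.+1 => df F j end |}.
Local Notation G := augmented.

Hypothesis hF :
  minimal_resolution pi e (ideal_gen (linform pi l)) (zero_ideal (A := A)).

Lemma augmentE (v : 'rV[A]_(rk F 0)) : v *m df G 0 = (augment e v)%:M.
Proof.
apply/rowP => b; rewrite ord1 !mxE mulr1n.
by apply: eq_bigr => a _; rewrite mxE.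
Qed.

Lemma ideal_augment y :
  ideal_gen (linform pi l) y <-> exists u : 'rV[A]_(rk G 1), y%:M = u *m df G 0.
Proof.
have [hres _] := hF; split=> [/(aug_surj hres)[v]|[u]].
  by rewrite /zero_ideal => /subr0_eq ->; exists v; rewrite augmentE.
rewrite augmentE => /matrixP/(_ 0 0); rewrite !mxE !mulr1n => ->.
have [c hc] := fin_all_exists (aug_in hres).
exists (fun j => \sum_b u 0 b * c b j).
under [RHS]eq_bigr do rewrite mulr_suml.
rewrite exchange_big; apply: eq_bigr => b _ /=.
by rewrite hc mulr_sumr; apply: eq_bigr => j _; rewrite mulrA.
Qed.

Lemma augmented_graded i (a : 'I_(rk G i.+1)) :
  component pi (dg a) (row a (df G i)).
Proof.
have [hres _] := hF; case: i a => [|i] a; last exact: (res_graded hres).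
move=> b; rewrite !mxE /shifted_piece /= subn0.
exact: (aug_graded hres).
Qed.

Lemma augmented_exact i (v : 'rV[A]_(rk G i.+1)) :
  v *m df G i = 0 <-> exists w, v = w *m df G i.+1.
Proof.
have [hres _] := hF; case: i v => [|i] v; last exact: (res_exact hres).
rewrite -(aug_exact hres) augmentE /zero_ideal; split=> [/matrixP/(_ 0 0)|->].
  by rewrite !mxE.
by apply/matrixP => i j; rewrite !mxE mul0rn.
Qed.

Lemma augmented_minimal : minimal pi G.
Proof.
have [hres hmin] := hF; case=> [|i] a b; last exact: hmin.
rewrite mxE; have [c ->] := aug_in hres a.
apply: irrelevant_sum => j _; apply: irrelevantM.
have [c' ->] := piece1P (piece_linform pi l j).
by exists (fun i => (c' i)%:A); apply: eq_bigr => i _; rewrite mulr_algl.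
Qed.

(** The identification of B_0^* with k by evaluation at 1. *)
Definition strand0 : 'M[k]_(rk K 0, rk G 0) :=
  \matrix_(s, b) evw (theta (vbasis {: Bdual pi l 0})`_s) [::].

Lemma mul_strand0 (r : 'rV[A]_(rk K 0)) : r *m strand0^A = (tensor r [::])%:M.
Proof.
apply/rowP => b; rewrite ord1 !mxE mulr1n; apply: eq_bigr => s _.
by rewrite !mxE /= mulrC mulr_algl.
Qed.

Lemma mul_strand0_scalar (c : 'rV[k]_(rk K 0)) :
  c *m strand0 = (evw (theta (vec c)) [::])%:M.
Proof.
apply/rowP => b; rewrite ord1 evw_theta_vec !mxE mulr1n.
by apply: eq_bigr => s _; rewrite mxE.
Qed.

Lemma strand0_iso : strand_iso strand0.
Proof.
split=> [c b|c c0|w _|C]; first by [].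
- apply/vec_eq0/theta_inj/ffunP => w; rewrite linear0 [RHS]ffunE -evwE.
  move: c0; rewrite mul_strand0_scalar => /matrixP/(_ 0 0).
  by rewrite !mxE mulr1n (tuple0 w).
- have [c hc] := vec0_onto pi l (w 0 0).
  exists c; rewrite mul_strand0_scalar hc.
  by apply/rowP => b; rewrite ord1 mxE mulr1n.
by rewrite mul_strand0 -ideal_augment; apply: df0_linear_exact.
Qed.

Lemma resolution_chain :
  exists phi : forall i, 'M[k]_(rk K i, rk G i),
  [/\ phi 0 = strand0, forall i, strand_iso (phi i)
    & forall i, df K i *m (phi i)^A = (phi i.+1)^A *m df G i].
Proof.
apply: strand_chain; last exact: strand0_iso.
- exact: augmented_graded.
- exact: augmented_exact.
exact: augmented_minimal.
Qed.

End Resolution.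
End Comparison.

(** * The two parts of the theorem *)

Section Conclusion.
Variables (k : fieldType) (n : nat) (A : comAlgType k).
Variable pi : {lrmorphism {mpoly k[n]} -> A}.
Hypothesis hA : standard_graded pi.
Variables (p : nat) (l : 'I_p -> tens k n 1).
Local Notation K := (dual_complex pi l).
Local Notation "c ^A" := (map_mx (in_alg A) c) (at level 2, format "c ^A").

Section Strand.
Variables (F : gfcomplex A) (e : 'I_(rk F 0) -> A).
Hypothesis hF :
  minimal_resolution pi e (ideal_gen (linform pi l)) (zero_ideal (A := A)).
Local Notation G := (augmented e).

Let G_graded := augmented_graded hF.
Let G_exact := augmented_exact hF.
Let G_minimal := augmented_minimal hF.

Lemma resolution_dg_gt i (b : 'I_(rk F i)) : (i < dg b)%N.
Proof. exact: (@dg_ge _ _ _ _ hA G G_graded G_exact G_minimal i.+1 b). Qed.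

Lemma component_lt i j (v : 'rV[A]_(rk F i)) :
  (j <= i)%N -> component pi j v -> v = 0.
Proof.
move=> leji hv; apply/rowP => b; rewrite mxE.
have := hv b; rewrite /shifted_piece leqNgt.
by rewrite (leq_ltn_trans leji (resolution_dg_gt b)).
Qed.

(** The l_j have preimages of degree 1 in F_0. *)
Lemma linform_eq0 : (forall v : 'rV[A]_(rk F 0), component pi 1 v -> v = 0) ->
  forall j, linform pi l j = 0.
Proof.
move=> hv j.
have /(ideal_augment hF)[u hu] : ideal_gen (linform pi l) (linform pi l j).
  exists (fun i => (i == j)%:R).
  rewrite (bigD1 j) //= eqxx mul1r big1 ?addr0 //.
  by move=> i /negbTE->; rewrite mul0r.
have hc : @component _ _ _ pi G 0 1 (linform pi l j)%:M.
  by move=> b; rewrite ord1 mxE mulr1n; apply: piece_linform.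
have [u' /hv u0 uE] := homogeneous_preimage hA G_graded hc hu.
by move: uE; rewrite u0 mul0mx => /matrixP/(_ 0 0); rewrite !mxE mulr1n.
Qed.

(** If F_0 had no part of degree 1, the ideal would vanish, and the
    generators of F_0 would be cycles outside the maximal ideal. *)
Lemma resolution_component1 (b : 'I_(rk F 0)) :
  ~ forall v : 'rV[A]_(rk F 0), component pi 1 v -> v = 0.
Proof.
move=> /linform_eq0 l0; have [c eb] := aug_in hF.1 b.
have : (delta_mx 0 b : 'rV[k]_(rk G 1)) = 0.
  apply: (scalar_ker hA G_exact G_minimal).
  rewrite map_delta_mx -rowE; apply/rowP => j; rewrite !mxE eb.
  by rewrite big1 // => i _; rewrite l0 mulr0.
by move=> /matrixP/(_ 0 b)/eqP; rewrite !mxE !eqxx oner_eq0.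
Qed.

Lemma initial_degree1 d : initial_degree pi F d -> d = 1.
Proof.
move=> [[v hv v0] hlow].
have [b _] : exists b : 'I_(rk F 0), True.
  apply: NNPP => hn; case/eqP: v0; apply/rowP => b; case: hn; by exists b.
case: d hv hlow => [|[|d]] hv hlow //.
  by case/eqP: v0; apply: component_lt hv.
by case: (resolution_component1 b) => w; apply: hlow.
Qed.

(** The isomorphism is phi with scalars extended to A.  The initial degree
    is 1 as soon as some B_i^* with i > 0 is nonzero, since then B_1^* is. *)
Lemma linear_strand_dual : iso_linear_strand pi (tail_complex K) F.
Proof.
have [phi [_ hphi comm]] := resolution_chain hA hF.
(* a differential that is injective on scalars cannot start from a nonzero
   module and end in a zero one *)
have rk1 i : 'I_(rk K i.+1) -> 'I_(rk K 1).
  elim: i => // i IH s; apply: IH.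
  case E: (rk K i.+1) => [|m]; last exact: ord0.
  have : (delta_mx 0 s : 'rV[k]_(rk K i.+2)) = 0.
    apply: (df_scalar_inj hA); apply/rowP => t; exfalso.
    by move: t; rewrite E; case.
  by move=> /matrixP/(_ 0 s)/eqP; rewrite !mxE !eqxx oner_eq0.
have comp_row i (s : 'I_(rk K i.+1)) :
    @component _ _ _ pi F i i.+1 (row s (phi i.+1)^A).
  rewrite rowE -(map_delta_mx (in_alg A)) -map_mxM.
  have := @si_supported _ _ _ _ _ _ _ _ _ (hphi i.+1) (delta_mx 0 s).
  exact: (@supported_component _ _ _ pi G i.+1).
have init (s : 'I_(rk K 1)) : initial_degree pi F 1.
  split; last by move=> j v; rewrite ltnS; apply: component_lt.
  exists (row s (phi 1%N)^A); first exact: comp_row.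
  apply/eqP => s0; have : (delta_mx 0 s : 'rV[k]_(rk K 1)) = 0.
    apply: (si_inj (hphi 1%N)); apply/rowP => b.
    have := congr1 (fun M : 'rV_ _ => M 0 b) s0.
    rewrite -rowE /= !mxE /= => /eqP.
    by rewrite scaler_eq0 oner_eq0 orbF => /eqP.
  by move=> /matrixP/(_ 0 s)/eqP; rewrite !mxE !eqxx oner_eq0.
exists (fun i => (phi i.+1)^A); split.
- by move=> i a; apply: comp_row.
- by move=> i v; apply: row_free_in_alg => c; apply: (si_inj (hphi i.+1)).
- move=> i w; split=> [[r [a [s [hs ->]]]]|[v ->]].
    have /fin_all_exists[v hv] t : exists v, s t = v *m (phi i.+1)^A.
      have [d /initial_degree1 -> ht] := hs t.
      have [u -> hu] :=
        component_bottom hA G_graded G_exact G_minimal (i := i.+1) ht.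
      by have [c ->] := si_onto (hphi i.+1) hu; exists c^A; rewrite map_mxM.
    exists (\sum_t a t *: v t); rewrite mulmx_suml; apply: eq_bigr => t _.
    by rewrite hv scalemxAl.
  exists (rk K i.+1), (fun s => v 0 s), (fun s => row s (phi i.+1)^A).
  split=> [s|]; last exact: mulmx_sum_row.
  by exists 1%N; [apply/init/rk1/s | apply: comp_row].
by move=> i; apply: (comm i.+1).
Qed.

Hypothesis F_linear : forall i (b : 'I_(rk F i)), dg b = i.+1.

(** Since F_i is generated in degree i + 1, phi is an isomorphism of complexes, and
    exactness is carried back from G. *)
Lemma linear_resolution_dual :
  minimal_resolution pi (@dual_augmentation _ _ _ pi _ l)
    (unit_ideal (A := A)) (ideal_gen (linform pi l)).
Proof.
have [phi [phi0 hphi comm]] := resolution_chain hA hF.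
have inj i := si_mono (hphi i).
have onto i (w : 'rV[A]_(rk G i)) : exists v, w = v *m (phi i)^A.
  have /fin_all_exists[c hc] b :
      exists c, (delta_mx 0 b : 'rV[k]__) = c *m phi i.
    apply: (si_onto (hphi i)) => a _.
    by case: i a {b w} => [|i] a //=; apply: F_linear.
  exists (\sum_b w 0 b *: (c b)^A); rewrite mulmx_suml [LHS]row_sum_delta.
  apply: eq_bigr => b _.
  by rewrite -scalemxAl -map_mxM -hc map_delta_mx.
have exactK i (v : 'rV[A]_(rk K i)) u :
    v *m (phi i)^A = u *m df G i -> exists w, v = w *m df K i.
  have [w ->] := onto _ u; rewrite -mulmxA -comm mulmxA => /inj ->.
  by exists w.
have augE (v : 'rV[A]_(rk K 0)) :
    v *m (phi 0)^A = (augment (@dual_augmentation _ _ _ pi _ l) v)%:M.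
  by rewrite phi0 mul_strand0 augment_tensor.
have entry i a b : exists c : 'I_n -> k, df K i a b = \sum_j c j *: gen pi j.
  by rewrite mxE; eexists.
split; last first.
  move=> i a b; have [c ->] := entry i a b.
  by exists (fun i => (c i)%:A); apply: eq_bigr => j _; rewrite mulr_algl.
split=> //.
- move=> i a b; rewrite mxE /shifted_piece leqnSn subSnn.
  by have [c ->] := entry i a b; apply: piece1_linear.
- move=> i v; split=> [v0|[w ->]]; last exact: df_df.
  have /G_exact[u hu] : v *m (phi i.+1)^A *m df G i = 0.
    by rewrite -mulmxA -comm mulmxA v0 mul0mx.
  exact: (exactK i.+1 v u hu).
- by move=> b; apply: piece_scalar.
- move=> y _; have [v hv] := onto 0%N (y%:M); exists v.
  move: hv; rewrite augE => /matrixP/(_ 0 0); rewrite !mxE !mulr1n => <-.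
  by rewrite subrr; exists (fun=> 0); rewrite big1 // => j _; rewrite mul0r.
move=> v; rewrite (ideal_augment hF) -augE; split=> [[u]|[w ->]].
  exact: (exactK 0%N).
by exists (w *m (phi 1%N)^A); rewrite -!mulmxA comm.
Qed.

End Strand.
End Conclusion.

Theorem proposition3p8 (k : fieldType) (n : nat) (A : comAlgType k)
    (pi : {lrmorphism {mpoly k[n]} -> A}) (hA : standard_graded pi)
    (hK : Koszul pi)
    (p : nat) (l : 'I_p -> tens k n 1)
    (hl : minimally_generates (linform pi l)) :
  (forall (F : gfcomplex A) (e : 'I_(rk F 0) -> A),
      minimal_resolution pi e (ideal_gen (linform pi l)) (zero_ideal (A := A)) ->
      iso_linear_strand pi (tail_complex (dual_complex pi l)) F)
  /\
  (universally_Koszul pi ->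
      minimal_resolution pi (@dual_augmentation k n A pi p l)
        (unit_ideal (A := A)) (ideal_gen (linform pi l))).
Proof.
split=> [F e hF|[_ /(_ p l)[F [e [hF F_linear]]]]].
  exact: linear_strand_dual hF.
exact: linear_resolution_dual hF F_linear.
Qed.
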